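(* Given $\bm U=(\bm y,\bm W,\bm S)\in\mathbb{R}^m\times\mathbb{S}^n\times\mathbb{S}^n$, the projection $$P_{\mathcal{M}}(\bm U)=(\bm y,\,P_{\mathcal{W}}(\bm W),\,P_{\mathcal{S}}(\bm S))$$ onto $\mathcal{M}=\mathbb{R}^m\times\mathcal{W}\times\mathcal{S}$ can be computed in $O(n^2\log n)$ operations.
   Context: $\mathbb{S}^n$ is the space of real symmetric $n\times n$ matrices with inner product $\bm A\bullet\bm X=\sum_{i,j}A_{ij}X_{ij}$ and Frobenius norm; $\|\bm W\|_\infty=\max_{i,j}|W_{ij}|$. The space $\mathbb{R}^m\times\mathbb{S}^n\times\mathbb{S}^n$ carries the sum of the component inner products and the induced norm; $P_\Omega$ denotes the orthogonal projection onto a closed convex set $\Omega$. Constants $\rho,\lambda>0$ are given. Put $\bar n=n(n-1)/2$ and let $\mathcal{K}$ be a fixed bijection (enumeration) from $\{(i,j):1\le i<j\le n\}$ to $\{1,\dots,\bar n\}$. For $\bm Z\in\mathbb{S}^{\bar n}$ let $\mathcal{Q}^\top(\bm Z)\in\mathbb{S}^n$ be the symmetric matrix with zero diagonal and, for $i<j$ and $a=\mathcal{K}(i,j)$, $[\mathcal{Q}^\top(\bm Z)]_{ij}=\sum_{l>a}Z_{a,l}-\sum_{l<a}Z_{l,a}$. Then $\mathcal{W}=\{\bm W\in\mathbb{S}^n:\|\bm W\|_\infty\le\rho\}$ and $\mathcal{S}=\{\mathcal{Q}^\top(\bm Z):\bm Z\in\mathbb{S}^{\bar n},\ \|\bm Z\|_\infty\le\lambda\}$.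 Here $m$ is the dimension of the target of a surjective linear map $\mathbb{S}^n\to\mathbb{R}^m$ (so $m\le n(n+1)/2$). Operations are exact arithmetic operations and comparisons on real numbers (together with the usual indexing of arrays); the constant in $O(\cdot)$ is absolute. *)

(* Defs.v *)
From mathcomp Require Import all_boot all_order all_algebra.
From mathcomp Require Import all_classical all_reals all_analysis.

Set Implicit Arguments.
Unset Strict Implicit.
Unset Printing Implicit Defensive.

Import Order.TTheory GRing.Theory Num.Theory.
Import numFieldNormedType.Exports.

Local Open Scope classical_set_scope.
Local Open Scope ring_scope.

(** * Projections *)

Section Projection.
Variables (R : realType) (V : zmodType) (ip : V -> V -> R).

Definition ipnorm (x : V) : R := Num.sqrt (ip x x).

(* [p] is the point of [Omega] closest to [x]; that it exists and is the only
   such point is part of the definition, so no default value is involved. *)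
Definition is_projection (Omega : set V) (x p : V) : Prop :=
  Omega p /\
  forall q, Omega q -> q <> p -> ipnorm (x - p) < ipnorm (x - q).

End Projection.

Notation triple R m n := ('cV[R]_m * 'M[R]_n * 'M[R]_n)%type.

Section Spaces.
Variable R : realType.

Definition mxdot (p q : nat) (A B : 'M[R]_(p, q)) : R :=
  \sum_i \sum_j A i j * B i j.

Definition Sym (n : nat) : set 'M[R]_n := [set A | A^T = A].

(* [A] restricts to a linear map from the symmetric matrices onto R^m; its
   values at non-symmetric matrices are irrelevant. *)
Definition linear_onto (n m : nat) (A : 'M[R]_n -> 'cV[R]_m) : Prop :=
  (forall (a : R) (X Y : 'M[R]_n), Sym X -> Sym Y ->
     A (a *: X + Y) = a *: A X + A Y) /\
  (forall y : 'cV[R]_m, exists2 X, Sym X & A X = y).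

Definition tripledot (m n : nat) (U V : triple R m n) : R :=
  mxdot U.1.1 V.1.1 + mxdot U.1.2 V.1.2 + mxdot U.2 V.2.

(** * The sets W, S and M *)

Definition upper (n : nat) : Type := {p : 'I_n * 'I_n | (p.1 < p.2)%N}.

Definition nbar (n : nat) : nat := ((n * n.-1)./2)%N.

(* Indices start at 0: an enumeration takes values in {0, ..., nbar n - 1}. *)
Definition enumeration (n : nat) : Type := upper n -> 'I_(nbar n).

Definition Qtr_entry (N : nat) (Z : 'M[R]_N) (a : 'I_N) : R :=
  \sum_(l < N | (a < l)%N) Z a l - \sum_(l < N | (l < a)%N) Z l a.

(* [insub (i, j)] is [Some] of the pair when i < j and [None] otherwise. *)
Definition Qtr (n : nat) (K : enumeration n) (Z : 'M[R]_(nbar n)) : 'M[R]_n :=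
  \matrix_(i, j)
    if (insub (i, j) : option (upper n)) is Some p then Qtr_entry Z (K p)
    else if (insub (j, i) : option (upper n)) is Some p then Qtr_entry Z (K p)
    else 0.

(* [mx_norm] is the largest absolute value of an entry. *)
Definition Wset (n : nat) (rho : R) : set 'M[R]_n :=
  [set W | Sym W /\ mx_norm W <= rho].

Definition Sset (n : nat) (K : enumeration n) (lam : R) : set 'M[R]_n :=
  [set Qtr K Z | Z in [set Z | Sym Z /\ mx_norm Z <= lam]].

Definition Mset (m n : nat) (K : enumeration n) (rho lam : R) :
    set (triple R m n) :=
  [set U | Wset rho U.1.2 /\ Sset K lam U.2].

End Spaces.

Local Close Scope ring_scope.
Local Open Scope nat_scope.

(** * A uniform real-number machine

  A program is a fixed syntactic object over two separate sorts: real numbers,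
  with exact field operations, and natural numbers, which serve as indices.
  There is no conversion between the two sorts in either direction (in
  particular no rounding), and index arithmetic is limited to addition and
  truncated subtraction, so indices cannot be used to pack real data or to
  compute long results in one step.  Each sort has scalar variables and
  two-dimensional arrays, both named by natural numbers; a vector is an array
  of which only column 0 is used.  Names are literals of the program: only
  the positions inside an array are computed. *)

Inductive iexp :=
  | ICst of nat
  | IVar of nat
  | IGet of nat & iexp & iexp
  | IAdd of iexp & iexp
  | ISub of iexp & iexp.

Inductive rexp :=
  | RCst of nat
  | RVar of nat
  | RGet of nat & iexp & iexp
  | RAdd of rexp & rexp
  | RSub of rexp & rexp
  | RMul of rexp & rexp
  | RDiv of rexp & rexp.

Inductive bexp :=
  | BIle of iexp & iexp
  | BRle of rexp & rexp
  | BNot of bexp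
  | BAnd of bexp & bexp.

Inductive com :=
  | Skip
  | ISet of nat & iexp
  | RSet of nat & rexp
  | IPut of nat & iexp & iexp & iexp
  | RPut of nat & iexp & iexp & rexp
  | Seq of com & com
  | If of bexp & com & com
  | While of bexp & com.

(* The number of operations performed by an evaluation: every constant,
   variable access, array access, arithmetic operation, comparison and
   connective counts for one. *)
Fixpoint icost (e : iexp) : nat :=
  match e with
  | ICst _ | IVar _ => 1
  | IGet _ e1 e2 | IAdd e1 e2 | ISub e1 e2 => (icost e1 + icost e2).+1
  end.

Fixpoint rcost (e : rexp) : nat :=
  match e with
  | RCst _ | RVar _ => 1
  | RGet _ e1 e2 => (icost e1 + icost e2).+1
  | RAdd e1 e2 | RSub e1 e2 | RMul e1 e2 | RDiv e1 e2 =>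
      (rcost e1 + rcost e2).+1
  end.

Fixpoint bcost (b : bexp) : nat :=
  match b with
  | BIle e1 e2 => (icost e1 + icost e2).+1
  | BRle e1 e2 => (rcost e1 + rcost e2).+1
  | BNot b1 => (bcost b1).+1
  | BAnd b1 b2 => (bcost b1 + bcost b2).+1
  end.

Section Machine.
Variable R : realType.

Record state := State {
  ivar : nat -> nat;
  rvar : nat -> R;
  iarr : nat -> nat -> nat -> nat;
  rarr : nat -> nat -> nat -> R
}.

Fixpoint ieval (s : state) (e : iexp) : nat :=
  match e with
  | ICst k => k
  | IVar x => ivar s x
  | IGet a e1 e2 => iarr s a (ieval s e1) (ieval s e2)
  | IAdd e1 e2 => ieval s e1 + ieval s e2
  | ISub e1 e2 => ieval s e1 - ieval s e2
  end.

(* As everywhere in MathComp, x / 0 = 0. *)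
Fixpoint reval (s : state) (e : rexp) : R :=
  match e with
  | RCst k => k%:R%R
  | RVar x => rvar s x
  | RGet a e1 e2 => rarr s a (ieval s e1) (ieval s e2)
  | RAdd e1 e2 => (reval s e1 + reval s e2)%R
  | RSub e1 e2 => (reval s e1 - reval s e2)%R
  | RMul e1 e2 => (reval s e1 * reval s e2)%R
  | RDiv e1 e2 => (reval s e1 / reval s e2)%R
  end.

Fixpoint beval (s : state) (b : bexp) : bool :=
  match b with
  | BIle e1 e2 => ieval s e1 <= ieval s e2
  | BRle e1 e2 => (reval s e1 <= reval s e2)%R
  | BNot b1 => ~~ beval s b1
  | BAnd b1 b2 => beval s b1 && beval s b2
  end.

Definition upd (T : Type) (f : nat -> T) (x : nat) (v : T) : nat -> T :=
  fun y => if y == x then v else f y.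

Definition upd3 (T : Type) (f : nat -> nat -> nat -> T) (a i j : nat) (v : T) :
    nat -> nat -> nat -> T :=
  fun a' i' j' => if [&& a' == a, i' == i & j' == j] then v else f a' i' j'.

Definition set_ivar (s : state) x v : state :=
  State (upd (ivar s) x v) (rvar s) (iarr s) (rarr s).
Definition set_rvar (s : state) x v : state :=
  State (ivar s) (upd (rvar s) x v) (iarr s) (rarr s).
Definition set_iarr (s : state) a i j v : state :=
  State (ivar s) (rvar s) (upd3 (iarr s) a i j v) (rarr s).
Definition set_rarr (s : state) a i j v : state :=
  State (ivar s) (rvar s) (iarr s) (upd3 (rarr s) a i j v).

(* [exec c s s' t]: started in [s], the program [c] halts in [s'] after
   exactly [t] operations.  The semantics is deterministic. *)
Inductive exec : com -> state -> state -> nat -> Prop :=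
  | ESkip s : exec Skip s s 1
  | EISet s x e :
      exec (ISet x e) s (set_ivar s x (ieval s e)) (icost e).+1
  | ERSet s x e :
      exec (RSet x e) s (set_rvar s x (reval s e)) (rcost e).+1
  | EIPut s a e1 e2 e :
      exec (IPut a e1 e2 e) s
        (set_iarr s a (ieval s e1) (ieval s e2) (ieval s e))
        (icost e1 + icost e2 + icost e).+1
  | ERPut s a e1 e2 e :
      exec (RPut a e1 e2 e) s
        (set_rarr s a (ieval s e1) (ieval s e2) (reval s e))
        (icost e1 + icost e2 + rcost e).+1
  | ESeq c1 c2 s s1 s2 t1 t2 :
      exec c1 s s1 t1 -> exec c2 s1 s2 t2 -> exec (Seq c1 c2) s s2 (t1 + t2)
  | EIfT b c1 c2 s s1 t :
      beval s b -> exec c1 s s1 t -> exec (If b c1 c2) s s1 (bcost b + t).+1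
  | EIfF b c1 c2 s s1 t :
      ~~ beval s b -> exec c2 s s1 t -> exec (If b c1 c2) s s1 (bcost b + t).+1
  | EWhileF b c s :
      ~~ beval s b -> exec (While b c) s s (bcost b).+1
  | EWhileT b c s s1 s2 t1 t2 :
      beval s b -> exec c s s1 t1 -> exec (While b c) s1 s2 t2 ->
      exec (While b c) s s2 (bcost b + t1 + t2).+1.

(* Memory layout of the input.  The enumeration is available to the program as
   a table.  Cells that are not mentioned hold arbitrary values. *)
Definition holds_input (m n : nat) (K : enumeration n) (rho lam : R)
    (U : triple R m n) (s : state) : Prop :=
  [/\ ivar s 0 = n /\ ivar s 1 = m,
      rvar s 0 = rho /\ rvar s 1 = lam,
      (forall p : upper n, iarr s 0 (val p).1 (val p).2 = K p),
      (forall i : 'I_m, rarr s 0 i 0 = U.1.1 i ord0) &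
      (forall i j : 'I_n, rarr s 1 i j = U.1.2 i j) /\
      (forall i j : 'I_n, rarr s 2 i j = U.2 i j)].

(* The output goes to other arrays than the input, so that copying the first
   component is charged. *)
Definition holds_output (m n : nat) (V : triple R m n) (s : state) : Prop :=
  [/\ forall i : 'I_m, rarr s 3 i 0 = V.1.1 i ord0,
      forall i j : 'I_n, rarr s 4 i j = V.1.2 i j &
      forall i j : 'I_n, rarr s 5 i j = V.2 i j].

End Machine.

(* Main.v *)
(* Identify a symmetric matrix with zero diagonal with a vector of length
   N = n(n-1)/2.  Then S is the set of the vectors of row sums of antisymmetric
   N x N matrices with entries in [-lambda, lambda].  It is convex, invariant
   under permutations, and contains w = lambda (N-1, N-3, ..., 1-N), so by
   T-transforms it contains every nonincreasing vector majorized by w.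

   To project s, sort it decreasingly, let x = s - w, and let v be the vector of
   the slopes of the least concave majorant of the prefix sums of x.  The
   projection is p = s - v: it is nonincreasing and majorized by w, and Abel
   summation with complementary slackness gives <v, p> = <v, w>, which is the
   maximum of <v, .> over S because v is nonincreasing.

   Merge sort takes O(N log N) operations, and the majorant takes O(N) with a
   stack of vertices, since every vertex is pushed and popped at most once. *)

From mathcomp Require Import all_boot all_order all_algebra all_fingroup.
Require Import Defs.
From mathcomp Require Import all_classical all_reals all_analysis.
From mathcomp Require Import zify ring lra.

Set Implicit Arguments.
Unset Strict Implicit.
Unset Printing Implicit Defensive.

Import Order.TTheory GRing.Theory Num.Theory.
Import numFieldNormedType.Exports.

Local Open Scope classical_set_scope.
Local Open Scope ring_scope.

(** * Score vectors *)

(** Row sums of such antisymmetric matrices are the scores of tournaments with fractional results,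
    centred at 0 and scaled by lambda; the description of S by majorization is the continuous form
    of Landau's theorem on score sequences.

    Optimality always goes through one criterion: a point p of the set with <x - p, p - q> >= 0 for
    all q in it is the projection of x. For S it can be tested on vectors of length N: the diagonal
    of the given matrix is orthogonal to S, and every other entry is counted twice.

    No separate existence proof for the projection onto S is given. One run of the program yields a
    point satisfying the criterion, and uniqueness identifies it with the output of every other run,
    so neither stale memory nor ties in the sort matter.

    The machine shapes the program: without recursion the merge sort is bottom-up, and without a
    conversion from indices to reals, N and the positions 0, ..., N are also kept as real numbers.
    The surjective linear map enters only through m <= n^2, which pays for copying y. *)

Section Scores.
Variables (R : realType) (lam : R) (N : nat).

Definition score (f : 'I_N -> R) : Prop :=
  exists A : 'I_N -> 'I_N -> R,
    [/\ forall i j, A j i = - A i j, forall i j, `|A i j| <= lam &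
        forall i, f i = \sum_j A i j].

Lemma eq_score f g : f =1 g -> score f -> score g.
Proof. by move=> fg [A [A1 A2 A3]]; exists A; split=> // i; rewrite -fg. Qed.

Lemma score_perm f (s : {perm 'I_N}) : score f -> score (f \o s).
Proof.
move=> [A [A1 A2 A3]]; exists (fun i j => A (s i) (s j)); split=> // i /=.
by rewrite A3 (reindex_inj (@perm_inj _ s)).
Qed.

Lemma score_convex f g (t : R) : 0 <= t <= 1 -> score f -> score g ->
  score (fun i => (1 - t) * f i + t * g i).
Proof.
move=> /andP[t0 t1] [A [A1 A2 A3]] [B [B1 B2 B3]].
exists (fun i j => (1 - t) * A i j + t * B i j); split.
- by move=> i j; rewrite A1 B1; ring.
- move=> i j; apply: le_trans (ler_normD _ _) _; rewrite !normrM.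
  rewrite (ger0_norm t0) (@ger0_norm _ (1 - t)) ?subr_ge0 //.
  rewrite (_ : lam = (1 - t) * lam + t * lam); last by ring.
  by apply: lerD; apply: ler_wpM2l; rewrite ?subr_ge0.
- by move=> i; rewrite A3 B3 big_split /= !mulr_sumr.
Qed.

Lemma sum_delta_lt (j : 'I_N) (d : R) (l : nat) :
  \sum_(i < N | (i < l)%N) d * (i == j)%:R = if (j < l)%N then d else 0.
Proof.
case: ifP => jl.
  rewrite (bigD1 j) //= eqxx mulr1 big1 ?addr0 // => i /andP[_ /negPf->].
  by rewrite mulr0.
rewrite big1 // => i il; case: eqP => [ij|]; last by rewrite mulr0.
by rewrite -ij il in jl.
Qed.

(* Muirhead's argument: a T-transform, i.e. a convex combination of [x] with a
   transposition of [x], makes [x] agree with [p] at one more place. *)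
Lemma score_majorized (x p : 'I_N -> R) :
  score x -> (forall i j : 'I_N, (i <= j)%N -> p j <= p i) ->
  (forall l : nat, \sum_(i < N | (i < l)%N) p i <= \sum_(i < N | (i < l)%N) x i) ->
  \sum_i p i = \sum_i x i -> score p.
Proof.
have [m] := ubnP #|[set i | x i != p i]%SET|; elim: m x => // m IH x.
move=> xm Sx pN le_px eq_px.
have [/existsP[k0 k0P]|] := boolP [exists k, x k < p k]; last first.
  rewrite negb_exists => /forallP xp; apply: (eq_score _ Sx) => i.
  have px0 : \sum_i (x i - p i) = 0 by rewrite sumrB eq_px subrr.
  move: (px0) => /eqP; rewrite psumr_eq0; last first.
    by move=> j _; rewrite subr_ge0 leNgt; apply: xp.
  by move=> /allP/(_ i (mem_index_enum i)); rewrite subr_eq0 => /eqP.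
case: (@arg_minnP _ k0 (fun k => x k < p k) (fun k => k : nat) k0P) => k xpk kmin.
(* If x were at most p everywhere below k, the strict gap at k would push the prefix sum of p up to
   [k.+1] above that of x. *)
have [j0 j0P] : exists j : 'I_N, (j < k)%N && (p j < x j).
  apply/existsP; apply: contraT; rewrite negb_exists => /forallP nj.
  have := le_px k.+1; rewrite leNgt => /negP[].
  rewrite (bigD1 k) //= [ltRHS](bigD1 k) //=; apply: ltr_leD => //.
  apply: ler_sum => i /andP[ik ink]; have := nj i.
  have -> /= : (i < k)%N by rewrite ltn_neqAle ink -ltnS.
  by rewrite -leNgt.
case: (@arg_maxnP _ j0 (fun j => (j < k)%N && (p j < x j)) (fun k => k : nat) j0P) => j /andP[jk xpj] jmax.
have mid (i : 'I_N) : (j < i < k)%N -> x i = p i.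
  move=> /andP[ji ik]; apply/eqP; rewrite eq_le; apply/andP; split.
    rewrite leNgt; apply/negP => pxi.
    by have := jmax i; rewrite ik pxi /= => /(_ isT); rewrite /= leqNgt ji.
  rewrite leNgt; apply/negP => pxi.
  by have := kmin i pxi; rewrite leqNgt ik.
(* The largest transfer from place j to place k that overshoots at neither: it closes the gap at one
   of them, and in between x and p already agree. *)
pose d := Num.min (x j - p j) (p k - x k).
have d0 : 0 < d by rewrite lt_min !subr_gt0 xpj xpk.
have dj : d <= x j - p j by rewrite ge_min lexx.
have dk : d <= p k - x k by rewrite ge_min lexx orbT.
have pkj : p k <= p j by apply: pN; apply: ltnW.
have xkj : 0 < x j - x k by lra.
have kj : k == j = false by apply/negbTE; rewrite neq_ltn jk orbT.
have jk' : j == k = false by rewrite eq_sym.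
pose x' i := x i - d * (i == j)%:R + d * (i == k)%:R.
have x'j : x' j = x j - d by rewrite /x' eqxx jk' mulr1 mulr0 addr0.
have x'k : x' k = x k + d by rewrite /x' eqxx kj mulr1 mulr0 subr0.
have x'o i : i != j -> i != k -> x' i = x i.
  by rewrite /x' => /negPf-> /negPf->; rewrite mulr0 subr0 addr0.
have pre l : \sum_(i < N | (i < l)%N) x' i =
    \sum_(i < N | (i < l)%N) x i - (if (j < l)%N then d else 0)
      + (if (k < l)%N then d else 0).
  by rewrite big_split /= sumrB !sum_delta_lt.
apply: (IH x') => //.
- rewrite -ltnS; apply: leq_trans xm; rewrite ltnS; apply: proper_card.
  apply/properP; split.
    apply/fintype.subsetP => i; rewrite !inE.
    have [->|ij] := eqVneq i j; first by rewrite (gt_eqF xpj).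
    have [->|ik] := eqVneq i k; first by rewrite (lt_eqF xpk).
    by rewrite x'o.
  have : d = x j - p j \/ d = p k - x k.
    by rewrite /d; case: leP => _; [left|right].
  case=> de; [exists j|exists k]; rewrite !inE ?x'j ?x'k.
  + by rewrite gt_eqF.
  + by rewrite negbK de; apply/eqP; ring.
  + by rewrite lt_eqF.
  + by rewrite negbK de; apply/eqP; ring.
(* Since [x k < p k <= p j < x j], d is at most [x j - x k], so t lies in [0, 1]. *)
- pose t := d / (x j - x k).
  have td : t * (x j - x k) = d by rewrite divfK // gt_eqF.
  apply: (@eq_score (fun i => (1 - t) * x i + t * (x \o tperm j k) i)).
    move=> i /=; case: tpermP => [->|->|/eqP ij /eqP ik].
    + by rewrite x'j -td; ring.
    + by rewrite x'k -td; ring.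
    + by rewrite x'o //; ring.
  apply: score_convex => //; last exact: score_perm.
  by rewrite divr_ge0 ?(ltW d0) ?(ltW xkj) // ler_pdivrMr // mul1r; lra.
- move=> l; rewrite pre; have := le_px l.
  case: (ltnP k l) => kl; first by rewrite (ltn_trans jk kl) subrK.
  case: (ltnP j l) => jl; last by rewrite subr0 addr0.
  (* Here j < l <= k. The places strictly between j and l add nothing to the prefix of x - p, so the
     surplus at j alone has to cover d, and it does. *)
  move=> _; rewrite addr0 -subr_ge0.
  have -> : \sum_(i < N | (i < l)%N) x i - d - \sum_(i < N | (i < l)%N) p i =
            \sum_(i < N | (i < l)%N) (x i - p i) - d by rewrite sumrB; ring.
  rewrite (bigID (fun i : 'I_N => (i < j)%N)) /=.
  have -> : \sum_(i < N | (i < l)%N && ~~ (i < j)%N) (x i - p i) = x j - p j.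
    rewrite (bigD1 j) ?jl ?ltnn //= big1 ?addr0 // => i /andP[/andP[il ij] inj].
    rewrite mid ?subrr // (leq_trans il kl) andbT.
    by rewrite ltn_neqAle eq_sym inj /= leqNgt.
  have -> : \sum_(i < N | (i < l)%N && (i < j)%N) (x i - p i) =
            \sum_(i < N | (i < j)%N) (x i - p i).
    by apply: eq_bigl => i; case: (ltnP i j) => ij; rewrite ?andbF // (ltn_trans ij jl).
  have : 0 <= \sum_(i < N | (i < j)%N) (x i - p i) by rewrite sumrB subr_ge0.
  lra.
- rewrite eq_px; have := pre N.
  have e (F : 'I_N -> R) : \sum_(i < N | (i < N)%N) F i = \sum_i F i.
    by apply: eq_bigl => i; rewrite ltn_ord.
  by rewrite !e !ltn_ord => ->; ring.
Qed.

Definition extreme (i : nat) : R := lam * (N%:R - 1 - (i.*2)%:R).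

(** The transitive tournament, in which each index beats all larger ones. *)
Definition orient (i j : 'I_N) : R :=
  if (i < j)%N then lam else if (j < i)%N then - lam else 0.

Lemma sum_orient (i : 'I_N) : \sum_j orient i j = extreme i.
Proof.
(* The row is cut at an arbitrary column M, so that the induction does not move N; the second case
   covers cuts at or before the diagonal. *)
have sum_lt M : \sum_(j < M) (if (i < j)%N then lam else if (j < i)%N then - lam else 0)
    = if (i < M)%N then lam * (M%:R - 1 - (i.*2)%:R) else - (lam * M%:R).
  elim: M => [|M IHM]; first by rewrite big_ord0 ltn0 mulr0 oppr0.
  rewrite big_ord_recr /= IHM ltnS [(i <= M)%N]leq_eqVlt -natr1.
  by case: (ltngtP i M) => [_|_|->] /=; rewrite -?addnn ?natrD; ring.
by rewrite sum_lt ltn_ord.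
Qed.

Hypothesis lam0 : 0 <= lam.

Lemma orientN i j : orient j i = - orient i j.
Proof. by rewrite /orient; case: ltngtP; rewrite ?opprK ?oppr0. Qed.

Lemma score_extreme : score (fun i : 'I_N => extreme i).
Proof.
exists orient; split=> [||i]; [exact: orientN| |by rewrite sum_orient].
by move=> i j; rewrite /orient; case: ltngtP; rewrite ?normrN ?normr0 ?ger0_norm.
Qed.

(** Symmetrizing puts the differences of v in the coefficients. For monotone v their signs are
    known, so a linear functional of the scores can be maximized one entry of A at a time. *)
Lemma sum_antisym (v : 'I_N -> R) (A : 'I_N -> 'I_N -> R) :
  (forall i j, A j i = - A i j) ->
  (\sum_i v i * \sum_j A i j) *+ 2 = \sum_i \sum_j A i j * (v i - v j).
Proof.
move=> AN; under [RHS]eq_bigr => i _ do under eq_bigr => j _ do rewrite mulrBr.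
under [RHS]eq_bigr => i _ do rewrite sumrB.
rewrite sumrB [X in _ = _ - X]exchange_big /= mulr2n -sumrN.
congr (_ + _); apply: eq_bigr => i _.
  by rewrite mulr_sumr; apply: eq_bigr => j _; rewrite mulrC.
by rewrite -sumrN mulr_sumr; apply: eq_bigr => j _; rewrite AN; ring.
Qed.

Lemma score_le_extreme (v q : 'I_N -> R) :
  (forall i j : 'I_N, (i <= j)%N -> v j <= v i) -> score q ->
  \sum_i v i * q i <= \sum_i v i * extreme i.
Proof.
move=> vN [A [A1 A2 A3]]; rewrite -(ler_pMn2r (isT : 0 < 2)%N).
under eq_bigr => i _ do rewrite A3.
under [X in _ <= X *+ 2]eq_bigr => i _ do rewrite -sum_orient.
rewrite (sum_antisym _ A1) (sum_antisym _ orientN).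
apply: ler_sum => i _; apply: ler_sum => j _.
have := A2 i j; rewrite ler_norml => /andP[Al Ar].
rewrite /orient; case: ltngtP => ij.
- by rewrite ler_wpM2r // subr_ge0 vN // ltnW.
- by rewrite ler_wnM2r // subr_le0 vN // ltnW.
- by rewrite (ord_inj ij) subrr !mulr0.
Qed.

End Scores.

(** * Slopes of the concave majorant *)

Section Majorant.
Variable R : realType.
Implicit Types (f v X : nat -> R) (st : nat -> nat).

Definition psum (u : nat -> R) (k : nat) : R := \sum_(i < k) u i.

Lemma psumS u k : psum u k.+1 = psum u k + u k.
Proof. by rewrite /psum big_ord_recr. Qed.

Lemma psum_minn (N : nat) (u : nat -> R) (l : nat) :
  \sum_(i < N | (i < l)%N) u i = psum u (minn l N).
Proof.
rewrite /psum (big_ord_widen N) ?geq_minr //; apply: eq_bigl => i.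
by rewrite leq_min ltn_ord andbT.
Qed.

Lemma nonincreasing_below (N : nat) (u : nat -> R) :
  (forall k, (k.+1 < N)%N -> u k.+1 <= u k) ->
  forall i j, (i <= j)%N -> (j < N)%N -> u j <= u i.
Proof.
move=> uN i; elim=> [|j IH]; first by rewrite leqn0 => /eqP->.
rewrite leq_eqVlt => /orP[/eqP->//|ij] jN.
by apply: le_trans (uN _ jN) (IH ij (ltnW jN)).
Qed.

(* [v] is the list of slopes of the least concave majorant of the prefix sums of
   [x], given by its characteristic properties. *)
Definition majorant_slopes (N : nat) (x v : nat -> R) : Prop :=
  [/\ forall k, (k.+1 < N)%N -> v k.+1 <= v k,
      forall k, (k <= N)%N -> psum x k <= psum v k,
      psum x N = psum v N &
      forall k, (k.+1 < N)%N -> psum x k.+1 = psum v k.+1 \/ v k.+1 = v k].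

Section Optimality.
Variables (lam : R) (N : nat) (f v : nat -> R).
Hypothesis lam0 : 0 <= lam.
Hypothesis f_nonincr : forall k, (k.+1 < N)%N -> f k.+1 <= f k.
Let w := extreme lam N.
Let p k := f k - v k.
Hypothesis v_slopes : majorant_slopes N (fun k => f k - w k) v.

Let psumB u1 u2 k : psum (fun i => u1 i - u2 i) k = psum u1 k - psum u2 k.
Proof. by rewrite /psum sumrB. Qed.

Let le_pw k : (k <= N)%N -> psum p k <= psum w k.
Proof.
by move=> kN; have [_ /(_ k kN) + _ _] := v_slopes; rewrite !psumB; lra.
Qed.

Let eq_pw : psum p N = psum w N.
Proof. by have [_ _ + _] := v_slopes; rewrite !psumB; lra. Qed.

Let p_nonincr k : (k.+1 < N)%N -> p k.+1 <= p k.
Proof.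
move=> kN; have [_ maj eqN /(_ k kN)] := v_slopes; rewrite /p.
case=> [touch|->]; last by have := f_nonincr kN; lra.
(* With x = f - w, the prefix sums touch at [k.+1], so the majorant inequalities at k and [k.+2]
   give [v k <= x k] and [v k.+1 >= x k.+1]. Hence [p k.+1 <= w k.+1 <= w k <= p k]. *)
have := maj k (ltnW (ltnW kN)); have := maj k.+2 kN.
move: touch; rewrite !psumS /= /w /extreme => t1 t2 t3.
have : lam * (k.+1.*2)%:R = lam * (k.*2)%:R + lam + lam.
  by rewrite doubleS -!natr1; ring.
move: t1 t2 t3; rewrite !mulrBr; move: lam0; lra.
Qed.

Lemma score_majorant_diff : score lam (fun i : 'I_N => p i).
Proof.
apply: (score_majorized (score_extreme N lam0)).
- by move=> i j ij; apply: nonincreasing_below ij (ltn_ord j).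
- by move=> l; rewrite !psum_minn le_pw // geq_minr.
- exact: eq_pw.
Qed.

Lemma majorant_optimal (q : 'I_N -> R) : score lam q ->
  \sum_(i < N) v i * (q i - p i) <= 0.
Proof.
have [vN _ _ slack] := v_slopes.
move=> /(score_le_extreme (v := fun i : 'I_N => v i)) qw.
have {}qw := qw (fun i j ij => nonincreasing_below vN ij (ltn_ord j)).
(* On every initial segment the sum collapses to its boundary term; at N that term vanishes because
   p and w have the same total. *)
have abel k : (k < N)%N ->
    \sum_(i < k.+1) v i * (w i - p i) = v k * (psum w k.+1 - psum p k.+1).
  elim: k => [|k IH] kN.
    by rewrite big_ord1 /psum !big_ord1.
  rewrite big_ord_recr /= IH; last exact: ltnW.
  rewrite ![psum _ k.+2]psumS; case: (slack k kN) => [touch|->]; last by ring.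
  have -> : psum w k.+1 = psum p k.+1 by move: touch; rewrite !psumB; lra.
  by ring.
have : \sum_(i < N) v i * (w i - p i) = 0.
  case: (posnP N) => [->|N0]; first by rewrite big_ord0.
  by rewrite -(prednK N0) abel ?prednK // eq_pw subrr mulr0.
under eq_bigr do rewrite mulrBr.
under [X in _ -> X <= _]eq_bigr do rewrite mulrBr.
by rewrite !sumrB; move: qw; rewrite -/w; lra.
Qed.

End Optimality.

Definition slope X (a b : nat) : R := (X b - X a) / (b%:R - a%:R).

Definition chord_above X (a b : nat) : Prop :=
  forall i, (a <= i <= b)%N -> X i <= X a + slope X a b * (i%:R - a%:R).

Lemma slopeE X a b : (a < b)%N -> slope X a b * (b%:R - a%:R) = X b - X a.
Proof. by move=> ab; rewrite divfK // subr_eq0 eqr_nat gtn_eqF. Qed.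

Lemma chord_above_succ X a : chord_above X a a.+1.
Proof.
move=> i /andP[ai]; rewrite leq_eqVlt => /orP[/eqP->|].
  by rewrite slopeE // addrC subrK.
rewrite ltnS => ia; have -> : i = a by apply/eqP; rewrite eqn_leq ia.
by rewrite subrr mulr0 addr0.
Qed.

(** The slope of the long chord is a weighted mean of the two short ones, so it lies between them,
    and the long chord passes above both short chords. *)
Lemma chord_above_merge X a b c : (a < b < c)%N ->
  slope X a b <= slope X b c -> chord_above X a b -> chord_above X b c ->
  chord_above X a c.
Proof.
move=> /andP[ab bc] s12 ch1 ch2 i /andP[ai ic].
have e1 := slopeE X ab; have e2 := slopeE X bc.
have e := slopeE X (ltn_trans ab bc).
have pab : 0 < b%:R - a%:R :> R by rewrite subr_gt0 ltr_nat.
have pbc : 0 < c%:R - b%:R :> R by rewrite subr_gt0 ltr_nat.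
set s1 := slope X a b in e1 s12 *; set s2 := slope X b c in e2 s12 *.
set s := slope X a c in e *.
have s1s : s1 <= s.
  rewrite -(ler_pM2r (_ : 0 < c%:R - a%:R)); last by lra.
  have : s1 * (c%:R - b%:R) <= s2 * (c%:R - b%:R) by rewrite ler_pM2r.
  by nra.
have ss2 : s <= s2.
  rewrite -(ler_pM2r (_ : 0 < c%:R - a%:R)); last by lra.
  have : s1 * (b%:R - a%:R) <= s2 * (b%:R - a%:R) by rewrite ler_pM2r.
  by nra.
case: (leqP i b) => ib.
  have := ch1 i; rewrite ai ib => /(_ isT) /le_trans; apply.
  by rewrite lerD2l ler_wpM2r // subr_ge0 ler_nat.
have := ch2 i; rewrite (ltnW ib) ic => /(_ isT) /le_trans; apply.
have : s * (c%:R - i%:R) <= s2 * (c%:R - i%:R).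
  by rewrite ler_wpM2r // subr_ge0 ler_nat.
rewrite -/s2; move: e2 e; lra.
Qed.

(** The entries 0, ..., b of the stack are the abscissae of the vertices of a concave polygonal line
    over [0, k] that meets X at its vertices and lies above X elsewhere. *)
Definition hull X st (b k : nat) : Prop :=
  [/\ st 0%N = 0%N, st b = k, forall j, (j < b)%N -> (st j < st j.+1)%N,
      forall j, (j.+1 < b)%N ->
        slope X (st j.+1) (st j.+2) < slope X (st j) (st j.+1) &
      forall j, (j < b)%N -> chord_above X (st j) (st j.+1)].

(** [psum v] is the polygonal line itself ([Gseg]) and meets [psum x] at the vertices ([Gst]). As v
    can change only at a vertex, the complementary slackness clause follows. *)
Lemma hull_slopes x v st b N : hull (psum x) st b N ->
  (forall k, (k < N)%N -> exists j, [/\ (j < b)%N, (st j <= k < st j.+1)%N &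
     v k = slope (psum x) (st j) (st j.+1)]) ->
  majorant_slopes N x v.
Proof.
move=> [st0 stb stS sl ch] vE; set X := psum x in sl ch vE.
have st_mono i j : (i <= j <= b)%N -> (st i <= st j)%N.
  elim: j => [|j IH]; first by rewrite leqn0 => /andP[/eqP->].
  move=> /andP[]; rewrite leq_eqVlt => /orP[/eqP->//|ij] jb.
  by apply: leq_trans (ltnW (stS j jb)); rewrite IH // -ltnS ij ltnW.
have seg_le j j' k k' : (j < b)%N -> (j' < b)%N -> (st j <= k)%N ->
    (k' < st j'.+1)%N -> (k <= k')%N -> (j <= j')%N.
  move=> jb jb' sk sk' kk'; rewrite leqNgt; apply/negP => jj'.
  have : (st j'.+1 <= st j)%N by rewrite st_mono // jj' ltnW.
  by lia.
have vseg j k : (j < b)%N -> (st j <= k < st j.+1)%N ->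
    v k = slope X (st j) (st j.+1).
  move=> jb /andP[sk sk'].
  have kN : (k < N)%N by rewrite -stb (leq_trans sk') // st_mono // jb leqnn.
  have [i [ib /andP[si si'] ->]] := vE k kN.
  suff -> : i = j by [].
  apply/eqP; rewrite eqn_leq (seg_le i j k k) //=.
  by rewrite (seg_le j i k k).
have Gseg j i : (j < b)%N -> psum v (st j) = X (st j) ->
    (st j <= i <= st j.+1)%N ->
    psum v i = X (st j) + slope X (st j) (st j.+1) * (i%:R - (st j)%:R).
  move=> jb Gj; elim: i => [|i IH].
    rewrite leqn0 => /andP[/eqP e _]; move: Gj; rewrite e => ->.
    by rewrite subrr mulr0 addr0.
  rewrite leq_eqVlt => /andP[/orP[/eqP<- _|]].
    by rewrite Gj subrr mulr0 addr0.
  rewrite ltnS => si si'; rewrite psumS IH ?si ?(ltnW si') //.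
  by rewrite (vseg j) ?si // -natr1; ring.
have Gst j : (j <= b)%N -> psum v (st j) = X (st j).
  elim: j => [|j IH] jb; first by rewrite st0 /X /psum !big_ord0.
  rewrite (Gseg j) ?IH ?leqnn ?(ltnW (stS j jb)) //; last exact: ltnW.
  by rewrite slopeE ?stS // addrC subrK.
split.
- move=> k kN; have [j' [jb' /andP[_ s2'] ->]] := vE _ kN.
  have [j [jb /andP[s1 _] ->]] := vE _ (ltnW kN).
  have jj' : (j <= j')%N by apply: (seg_le j j' k k.+1).
  apply: (nonincreasing_below (N := b) (u := fun j => slope X (st j) (st j.+1))) jj' jb'.
  by move=> i ib; apply: ltW; apply: sl.
- move=> k; rewrite leq_eqVlt => /orP[/eqP->|kN].
    by rewrite -{2}stb Gst // stb.
  have [j [jb /andP[s1 s2] _]] := vE _ kN.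
  rewrite (Gseg j) ?(Gst j (ltnW jb)) ?s1 ?(ltnW s2) //.
  by apply: ch => //; rewrite s1 ltnW.
- by rewrite -stb Gst.
- move=> k kN; have [j [jb /andP[s1 s2] ->]] := vE _ (ltnW kN).
  case: (ltngtP k.+1 (st j.+1)) s2 => // [s2 _|e _].
    by right; rewrite (vseg j) // s2 leqW.
  by left; rewrite e Gst.
Qed.

End Majorant.

(** * Projections of matrices *)

(** Expand the square of x - q = (x - p) + (p - q): the cross term is nonnegative and the last
    square is positive. The assumptions on [ip] are few enough to be checked directly for matrices
    and for triples. *)
Lemma projection_variational (R : realType) (V : zmodType) (ip : V -> V -> R)
    (Omega : set V) (x p : V) :
  (forall a b, ip (a + b) (a + b) = ip a a + ip a b *+ 2 + ip b b) ->
  (forall a, 0 <= ip a a) -> (forall a, a <> 0 -> 0 < ip a a) ->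
  Omega p -> (forall q, Omega q -> 0 <= ip (x - p) (p - q)) ->
  is_projection ip Omega x p.
Proof.
move=> sqD ge0 gt0 Op vi; split=> // q Oq qp.
have pq0 : 0 < ip (p - q) (p - q) by apply: gt0 => /subr0_eq /esym.
have -> : x - q = (x - p) + (p - q) by rewrite addrA subrK.
rewrite /ipnorm (sqD (x - p)); have := vi q Oq; have := ge0 (x - p) => xp0 xpq.
have lt : ip (x - p) (x - p) <
    ip (x - p) (x - p) + ip (x - p) (p - q) *+ 2 + ip (p - q) (p - q) by lra.
by rewrite ltr_sqrt //; apply: le_lt_trans xp0 lt.
Qed.

Lemma projection_unique (R : realType) (V : zmodType) (ip : V -> V -> R)
    (Omega : set V) (x p p' : V) :
  is_projection ip Omega x p -> is_projection ip Omega x p' -> p = p'.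
Proof.
move=> [Op pmin] [Op' pmin']; apply: contrapT => pp'.
have := pmin p' Op' (nesym pp'); have := pmin' p Op pp'.
by move=> /lt_trans h /h; rewrite ltxx.
Qed.

Section Matrices.
Variable R : realType.

Lemma mxdot_sqD p q (A B : 'M[R]_(p, q)) :
  mxdot (A + B) (A + B) = mxdot A A + mxdot A B *+ 2 + mxdot B B.
Proof.
rewrite /mxdot -sumrMnl -!big_split; apply: eq_bigr => i _ /=.
rewrite -sumrMnl -!big_split; apply: eq_bigr => j _ /=.
by rewrite !mxE; ring.
Qed.

Lemma mxdot_ge0 p q (A : 'M[R]_(p, q)) : 0 <= mxdot A A.
Proof. by apply: sumr_ge0 => i _; apply: sumr_ge0 => j _; apply: sqr_ge0. Qed.

Lemma mxdot_gt0 p q (A : 'M[R]_(p, q)) : A <> 0 -> 0 < mxdot A A.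
Proof.
move=> A0; rewrite lt0r mxdot_ge0 andbT; apply/negP => /eqP e; apply: A0.
have ge0 i : 0 <= \sum_j A i j * A i j by apply: sumr_ge0 => j _; apply: sqr_ge0.
apply/matrixP => i j; rewrite mxE; move/eqP: e; rewrite /mxdot psumr_eq0 //.
move=> /allP/(_ i (mem_index_enum i)) /=.
rewrite psumr_eq0 => [|k _]; last exact: sqr_ge0.
move=> /allP/(_ j (mem_index_enum j)) /=.
by rewrite mulf_eq0 orbb => /eqP.
Qed.

Lemma mxdot0l p q (A : 'M[R]_(p, q)) : mxdot 0 A = 0.
Proof. by apply: big1 => i _; apply: big1 => j _; rewrite mxE mul0r. Qed.

Lemma mx_norm_le p q (A : 'M[R]_(p, q)) (r : R) : 0 <= r ->
  mx_norm A <= r <-> forall i j, `|A i j| <= r.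
Proof.
move=> r0; rewrite mx_normrE; split=> [/bigmax_leP[_ h] i j|h].
  exact: (h (i, j)).
by apply/bigmax_leP; split=> // -[i j] _; apply: h.
Qed.

Definition clip (r x : R) : R := if x <= r then if - r <= x then x else - r else r.

Lemma clip_proj (n : nat) (r : R) (W : 'M[R]_n) : 0 < r -> Sym W ->
  Wset r (map_mx (clip r) W) /\
  forall Q, Wset r Q -> 0 <= mxdot (W - map_mx (clip r) W) (map_mx (clip r) W - Q).
Proof.
move=> r0 symW; split.
  split.
    by apply/matrixP => i j; rewrite !mxE -{1}(symW : W^T = W) mxE.
  apply/mx_norm_le; first exact: ltW.
  move=> i j; rewrite mxE /clip ler_norml.
  by case: (leP (W i j) r) => h1; [case: (leP (- r) (W i j)) => h2|]; apply/andP; split; lra.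
move=> Q [_ /(mx_norm_le _ (ltW r0)) Qr].
apply: sumr_ge0 => i _; apply: sumr_ge0 => j _; rewrite !mxE /clip.
have := Qr i j; rewrite ler_norml => /andP[Q1 Q2].
case: (leP (W i j) r) => h1; last by rewrite mulr_ge0 // subr_ge0 // ltW.
case: (leP (- r) (W i j)) => h2; first by rewrite subrr mul0r.
by rewrite mulr_le0 // subr_le0 // ltW.
Qed.

(* Preimages of the m unit vectors are linearly independent in the
   n^2-dimensional space of all matrices. *)
Lemma linear_onto_dim (n m : nat) (A : 'M[R]_n -> 'cV[R]_m) :
  linear_onto A -> (m <= n * n)%N.
Proof.
move=> [lin onto].
have symB (a : R) (X Y : 'M[R]_n) : Sym X -> Sym Y -> Sym (a *: X + Y).
  by rewrite /Sym /= => hX hY; rewrite linearD linearZ /= hX hY.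
have sym0 : Sym (0 : 'M[R]_n) by rewrite /Sym /= trmx0.
have A0 : A 0 = 0.
  have := lin 1 0 0 sym0 sym0; rewrite scale1r addr0 scale1r => e.
  by apply: (@addrI _ (A 0)); rewrite addr0 -e.
have [X XP] : exists X : 'I_m -> 'M[R]_n, forall i, Sym (X i) /\ A (X i) = delta_mx i 0.
  have /choice[X XP] : forall i : 'I_m, exists Xi, Sym Xi /\ A Xi = delta_mx i 0; last by exists X.
  move=> i.
  by have [Xi symXi AXi] := onto (delta_mx i 0); exists Xi.
(* [A] is linear on symmetric matrices only, so the symmetry of the partial sums is carried along
   the induction. *)
have Asum (u : 'rV[R]_m) (s : seq 'I_m) : Sym (\sum_(i <- s) u 0 i *: X i) /\
    A (\sum_(i <- s) u 0 i *: X i) = \sum_(i <- s) u 0 i *: delta_mx i 0.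
  elim: s => [|i s [IH1 IH2]]; first by rewrite !big_nil.
  have [Xs AX] := XP i; rewrite !big_cons; split; first exact: symB.
  by rewrite lin // IH2 AX.
pose M : 'M[R]_(m, n * n) := \matrix_i mxvec (X i).
have free : row_free M.
  apply: inj_row_free => u uM; have [_] := Asum u (index_enum _).
  have -> : \sum_(i <- index_enum _) u 0 i *: X i = 0.
    apply: (can_inj mxvecK); rewrite linear0 linear_sum /= -[RHS]uM.
    rewrite mulmx_sum_row; apply: eq_bigr => i _.
    by rewrite linearZ rowK.
  rewrite A0 => /esym/matrixP z; apply/rowP => i; rewrite mxE.
  have := z i 0; rewrite summxE mxE (bigD1 i) //= !mxE !eqxx mulr1 big1 ?addr0 //.
  by move=> j ji; rewrite !mxE eq_sym (negPf ji) mulr0.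
by move: free; rewrite /row_free => /eqP <-; apply: rank_leq_col.
Qed.

Variables (n : nat) (K : enumeration n).

Definition sym_of (c : 'I_(nbar n) -> R) : 'M[R]_n :=
  \matrix_(i, j)
    if (insub (i, j) : option (upper n)) is Some p then c (K p)
    else if (insub (j, i) : option (upper n)) is Some p then c (K p)
    else 0.

Lemma sym_of_lt c (p : upper n) : sym_of c (val p).1 (val p).2 = c (K p).
Proof. by rewrite mxE -surjective_pairing valK. Qed.

Lemma sym_of_sym c : Sym (sym_of c).
Proof.
apply/matrixP => i j; rewrite !mxE.
case: insubP => [p pij ep|]; case: insubP => [p' pji ep'|] //=.
by move: pij pji => /= h /(ltn_trans h); rewrite ltnn.
Qed.

Lemma sym_of_diag c (i j : 'I_n) : (i : nat) = j -> sym_of c i j = 0.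
Proof. by move=> ij; rewrite mxE !insubF //= ij ltnn. Qed.

(** Entries above and below the diagonal contribute equally, and the zero diagonal of [sym_of c]
    cancels whatever stands on that of B. *)
Lemma mxdot_sym_of (B : 'M[R]_n) (b c : 'I_(nbar n) -> R) :
  bijective K -> Sym B -> (forall p, B (val p).1 (val p).2 = b (K p)) ->
  mxdot B (sym_of c) = (\sum_a b a * c a) *+ 2.
Proof.
move=> bijK symB bB.
have -> : \sum_a b a * c a = \sum_(p : 'I_n * 'I_n | (p.1 < p.2)%N) B p.1 p.2 * sym_of c p.1 p.2.
  rewrite (reindex K) /=; last exact: onW_bij.
  rewrite [RHS](big_sub [pred p : 'I_n * 'I_n | (p.1 < p.2)%N]) /=.
  by apply: eq_bigr => p _; rewrite sym_of_lt bB.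
rewrite /mxdot pair_bigA /= (bigID (fun p : 'I_n * 'I_n => (p.1 < p.2)%N)) /= mulr2n.
congr (_ + _); rewrite (bigID (fun p : 'I_n * 'I_n => (p.2 < p.1)%N)) /= [X in _ + X]big1.
  rewrite addr0 (reindex (fun p : 'I_n * 'I_n => (p.2, p.1))) /=; last first.
    by apply: onW_bij; exists (fun p => (p.2, p.1)) => -[].
  apply: eq_big => [[i j]|[i j] _] /=; first by case: ltngtP.
  by rewrite -{1}(symB : B^T = B) -{1}(sym_of_sym c : _^T = _) !mxE.
move=> [i j] /=; rewrite -!leqNgt => /andP[ij ji].
by rewrite sym_of_diag ?mulr0 //; apply/eqP; rewrite eqn_leq ij ji.
Qed.

(** [Qtr_entry] reads Z above the diagonal only; changing the sign of the mirror image below it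
    turns the entry into a row sum of an antisymmetric matrix. *)
Lemma Sset_scores (lam : R) : 0 <= lam ->
  forall Q, Sset K lam Q <-> exists2 c, score lam c & Q = sym_of c.
Proof.
move=> lam0 Q; split=> [[Z [symZ /(mx_norm_le _ lam0) Zle] <-]|[c [A [AN Ale Ac]] ->]].
  exists (Qtr_entry Z) => //.
  exists (fun a l : 'I_(nbar n) => if (a < l)%N then Z a l else if (l < a)%N then - Z l a else 0).
  split=> [i j|i j|a].
  - by case: ltngtP; rewrite ?opprK ?oppr0.
  - by case: ltngtP; rewrite ?normrN ?normr0.
  - rewrite /Qtr_entry [RHS](bigID (fun l : 'I__ => (a < l)%N)) /=; congr (_ + _).
      by apply: eq_bigr => l ->.
    rewrite -sumrN [RHS](bigID (fun l : 'I__ => (l < a)%N)) /= [X in _ + X]big1 ?addr0.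
      apply: eq_big => [l|l la]; first by case: ltngtP.
      by rewrite la ltnNge (ltnW la).
    by move=> l /andP[/negPf-> /negPf->].
pose Z : 'M[R]_(nbar n) := \matrix_(a, l) if (a < l)%N then A a l else A l a.
exists Z.
  split; first by apply/matrixP => a l; rewrite !mxE; case: ltngtP => // /ord_inj->.
  by apply/mx_norm_le => // a l; rewrite mxE; case: ifP.
apply/matrixP => i j; rewrite !mxE.
have ZA a : Qtr_entry Z a = c a.
  rewrite Ac /Qtr_entry [RHS](bigID (fun l : 'I__ => (a < l)%N)) /=; congr (_ + _).
    by apply: eq_bigr => l al; rewrite mxE al.
  rewrite -sumrN [RHS](bigID (fun l : 'I__ => (l < a)%N)) /= [X in _ + X]big1 ?addr0.
    apply: eq_big => [l|l la]; first by case: ltngtP.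
    by rewrite mxE la AN opprK.
  move=> l /andP[al la]; have -> : l = a.
    by apply/ord_inj/eqP; move: al la; rewrite eqn_leq -!leqNgt => -> ->.
  by have := AN a a; lra.
by case: insubP => [p _ _|_]; [|case: insubP => [p _ _|_]]; rewrite ?ZA.
Qed.

(* [pi] sorts the entries of [f]; [v] is indexed by ranks. *)
Lemma Sset_proj (lam : R) (S : 'M[R]_n) (f g : nat -> R) (pi : nat -> nat)
    (v : nat -> R) (N := nbar n) :
  0 <= lam -> bijective K -> Sym S ->
  (forall p, f (K p) = S (val p).1 (val p).2) ->
  perm_eq [seq pi k | k <- iota 0 N] (iota 0 N) ->
  (forall k, (k.+1 < N)%N -> f (pi k.+1) <= f (pi k)) ->
  majorant_slopes N (fun k => f (pi k) - extreme lam N k) v ->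
  (forall k, (k < N)%N -> g (pi k) = f (pi k) - v k) ->
  let P := sym_of (fun a => g a) in
  Sset K lam P /\ forall Q, Sset K lam Q -> 0 <= mxdot (S - P) (P - Q).
Proof.
move=> lam0 bijK symS fS perm_pi f_sorted vP gE P.
have pi_lt k : (k < N)%N -> (pi k < N)%N.
  have := perm_mem perm_pi (pi k); rewrite mem_iota add0n /= => <- kN.
  by apply: map_f; rewrite mem_iota.
have pi_inj : {in gtn N &, injective pi}.
  have := perm_uniq perm_pi; rewrite iota_uniq => u i j iN jN e.
  have {}u : uniq [seq pi k | k <- iota 0 N] by rewrite u.
  apply/eqP; rewrite -(nth_uniq 0%N _ _ u) ?size_map ?size_iota //.
  by rewrite !(nth_map 0%N) ?size_iota // !nth_iota // !add0n e.
pose sg0 (k : 'I_N) : 'I_N := Ordinal (pi_lt k (ltn_ord k)).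
have sg_inj : injective sg0.
  by move=> i j [] /pi_inj => /(_ (ltn_ord i) (ltn_ord j)) /ord_inj.
pose sg := perm sg_inj.
have sgE k : (sg k : nat) = pi k by rewrite permE.
have score_p : score lam (fun k : 'I_N => f (pi k) - v k).
  exact: (score_majorant_diff lam0 f_sorted vP).
have score_g : score lam (fun a : 'I_N => g a).
  apply: (eq_score _ (score_perm (sg^-1)%g score_p)) => a /=.
  by rewrite -gE ?ltn_ord // -sgE permKV.
split; first by apply/Sset_scores => //; exists (fun a : 'I_N => g a).
move=> Q /(Sset_scores lam0)[q score_q ->].
have symP : Sym P by exact: sym_of_sym.
have -> : P - sym_of q = sym_of (fun a => g a - q a).
  apply/matrixP => i j; rewrite !mxE.
  by case: insubP => [p _ _|_]; [|case: insubP => [p _ _|_]]; rewrite ?subrr.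
rewrite (@mxdot_sym_of _ (fun a => f a - g a)) //; first last.
- by move=> p; rewrite mxE [X in _ + X]mxE /P sym_of_lt fS.
- by rewrite /Sym /= linearB /= symP symS.
(* Summed in the order of ranks, f - g becomes v, and up to sign the sum is that of
   [majorant_optimal] for the permuted q. *)
rewrite mulrn_wge0 // (reindex_inj (@perm_inj _ sg)) /=.
have := majorant_optimal vP (score_perm sg score_q).
rewrite -oppr_ge0 -sumrN; congr (_ <= _); apply: eq_bigr => k _ /=.
by rewrite !sgE gE ?ltn_ord //; ring.
Qed.

End Matrices.

Lemma is_projection_triple (R : realType) (m n : nat) (K : enumeration n)
    (rho lam : R) (y : 'cV[R]_m) (W S PW PS : 'M[R]_n) :
  Wset rho PW -> Sset K lam PS ->
  (forall Q, Wset rho Q -> 0 <= mxdot (W - PW) (PW - Q)) ->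
  (forall Q, Sset K lam Q -> 0 <= mxdot (S - PS) (PS - Q)) ->
  is_projection (@tripledot R m n) (Mset K rho lam) (y, W, S) (y, PW, PS).
Proof.
move=> hW hS viW viS; apply: projection_variational => //.
- by move=> [[a1 a2] a3] [[b1 b2] b3]; rewrite /tripledot /= !mxdot_sqD; ring.
- by move=> a; rewrite /tripledot !addr_ge0 // mxdot_ge0.
- move=> [[a1 a2] a3] a0; rewrite /tripledot /=.
  have [e1|/eqP/mxdot_gt0] := eqVneq a1 0; last first.
    by have := mxdot_ge0 a2; have := mxdot_ge0 a3; lra.
  have [e2|/eqP/mxdot_gt0] := eqVneq a2 0; last first.
    by have := mxdot_ge0 a1; have := mxdot_ge0 a3; lra.
  have [e3|/eqP/mxdot_gt0] := eqVneq a3 0; last first.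
    by have := mxdot_ge0 a1; have := mxdot_ge0 a2; lra.
  by case: a0; rewrite e1 e2 e3.
- move=> [[q1 q2] q3] [/= qW qS]; rewrite /tripledot /= subrr mxdot0l add0r.
  by rewrite addr_ge0 ?viW ?viS.
Qed.

(** * Time bounds for programs *)

Local Open Scope nat_scope.

Fixpoint ivars (c : com) : seq nat :=
  match c with
  | ISet x _ => [:: x]
  | Seq c1 c2 | If _ c1 c2 => ivars c1 ++ ivars c2
  | While _ c1 => ivars c1
  | _ => [::]
  end.

Fixpoint rvars (c : com) : seq nat :=
  match c with
  | RSet x _ => [:: x]
  | Seq c1 c2 | If _ c1 c2 => rvars c1 ++ rvars c2
  | While _ c1 => rvars c1
  | _ => [::]
  end.

Fixpoint iarrs (c : com) : seq nat :=
  match c with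
  | IPut a _ _ _ => [:: a]
  | Seq c1 c2 | If _ c1 c2 => iarrs c1 ++ iarrs c2
  | While _ c1 => iarrs c1
  | _ => [::]
  end.

Fixpoint rarrs (c : com) : seq nat :=
  match c with
  | RPut a _ _ _ => [:: a]
  | Seq c1 c2 | If _ c1 c2 => rarrs c1 ++ rarrs c2
  | While _ c1 => rarrs c1
  | _ => [::]
  end.

Fixpoint loopfree (c : com) : bool :=
  match c with
  | Seq c1 c2 | If _ c1 c2 => loopfree c1 && loopfree c2
  | While _ _ => false
  | _ => true
  end.

(** The 0 at [While], like the unchanged state in [sem], is a dummy: both functions are applied to
    loop-free code. *)
Fixpoint maxcost (c : com) : nat :=
  match c with
  | Skip => 1
  | ISet _ e => (icost e).+1
  | RSet _ e => (rcost e).+1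
  | IPut _ e1 e2 e => (icost e1 + icost e2 + icost e).+1
  | RPut _ e1 e2 e => (icost e1 + icost e2 + rcost e).+1
  | Seq c1 c2 => maxcost c1 + maxcost c2
  | If b c1 c2 => (bcost b + maxn (maxcost c1) (maxcost c2)).+1
  | While _ _ => 0
  end.

Definition Ilt (e1 e2 : iexp) : bexp := BNot (BIle e2 e1).

Definition For (x : nat) (e0 : iexp) (y : nat) (c : com) : com :=
  Seq (ISet x e0)
    (While (Ilt (IVar x) (IVar y)) (Seq c (ISet x (IAdd (IVar x) (ICst 1))))).

Section Logic.
Variable R : realType.
Implicit Types (s : state R) (c : com).

Fixpoint sem c s : state R :=
  match c with
  | Skip => s
  | ISet x e => set_ivar s x (ieval s e)
  | RSet x e => set_rvar s x (reval s e)
  | IPut a e1 e2 e => set_iarr s a (ieval s e1) (ieval s e2) (ieval s e)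
  | RPut a e1 e2 e => set_rarr s a (ieval s e1) (ieval s e2) (reval s e)
  | Seq c1 c2 => sem c2 (sem c1 s)
  | If b c1 c2 => if beval s b then sem c1 s else sem c2 s
  | While _ _ => s
  end.

(** A frame condition read off the syntax. [ok_seq], [ok_mono] and the loop rules supply it, so
    invariants need to mention only what a stage writes. *)
Definition agree c s s' : Prop :=
  [/\ forall x, x \notin ivars c -> ivar s' x = ivar s x,
      forall x, x \notin rvars c -> rvar s' x = rvar s x,
      forall a, a \notin iarrs c -> iarr s' a = iarr s a &
      forall a, a \notin rarrs c -> rarr s' a = rarr s a].

Lemma agree_refl c s : agree c s s. Proof. by []. Qed.

Lemma agree_trans c s1 s2 s3 : agree c s1 s2 -> agree c s2 s3 -> agree c s1 s3.
Proof.
move=> [a1 a2 a3 a4] [b1 b2 b3 b4].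
by split=> x hx; rewrite ?b1 ?b2 ?b3 ?b4 // ?a1 ?a2 ?a3 ?a4.
Qed.

Lemma agree_sub c c' s s' :
  {subset ivars c <= ivars c'} -> {subset rvars c <= rvars c'} ->
  {subset iarrs c <= iarrs c'} -> {subset rarrs c <= rarrs c'} ->
  agree c s s' -> agree c' s s'.
Proof.
move=> h1 h2 h3 h4 [a1 a2 a3 a4].
by split=> x hx; rewrite ?a1 ?a2 ?a3 ?a4 //; apply: contra hx; auto.
Qed.

Lemma exec_agree c s s' t : exec c s s' t -> agree c s s'.
Proof.
elim=> {c s s' t} //=.
- move=> s x e; split=> // y; rewrite inE => /negPf yx.
  by rewrite /= /upd yx.
- move=> s x e; split=> // y; rewrite inE => /negPf yx.
  by rewrite /= /upd yx.
- move=> s x e1 e2 e; split=> // y; rewrite inE => /negPf yx.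
  by rewrite /= /upd3 yx.
- move=> s x e1 e2 e; split=> // y; rewrite inE => /negPf yx.
  by rewrite /= /upd3 yx.
- move=> c1 c2 s s1 s2 t1 t2 _ h1 _ h2.
  apply: agree_trans (agree_sub _ _ _ _ h1) (agree_sub _ _ _ _ h2);
    by move=> x hx; rewrite /= mem_cat hx ?orbT.
- move=> b c1 c2 s s1 t _ _ h.
  by apply: agree_sub h => x hx; rewrite /= mem_cat hx ?orbT.
- move=> b c1 c2 s s1 t _ _ h.
  by apply: agree_sub h => x hx; rewrite /= mem_cat hx ?orbT.
- move=> b c s s1 s2 t1 t2 _ _ h1 _ h2; exact: agree_trans h1 h2.
Qed.

Definition ok c s (T : nat) (Q : state R -> Prop) : Prop :=
  exists s' t, [/\ exec c s s' t, t <= T & Q s'].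

Lemma ok_mono c s T T' (Q Q' : state R -> Prop) :
  ok c s T Q -> T <= T' -> (forall s', agree c s s' -> Q s' -> Q' s') ->
  ok c s T' Q'.
Proof.
move=> [s' [t [ex tT Qs]]] TT' QQ'; exists s', t; split=> //.
  exact: leq_trans TT'.
by apply: QQ' => //; apply: exec_agree ex.
Qed.

Lemma ok_seq c1 c2 s T1 T2 Q :
  ok c1 s T1 (fun s' => agree c1 s s' -> ok c2 s' T2 Q) ->
  ok (Seq c1 c2) s (T1 + T2) Q.
Proof.
move=> [s1 [t1 [ex1 tT1 /(_ (exec_agree ex1)) [s2 [t2 [ex2 tT2 Q2]]]]]].
by exists s2, (t1 + t2); split=> //; [apply: ESeq ex1 ex2|apply: leq_add].
Qed.

Lemma ok_block c s T (Q : state R -> Prop) :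
  loopfree c -> maxcost c <= T -> Q (sem c s) -> ok c s T Q.
Proof.
move=> lc cT Qs.
suff [t [ex tc]] : exists t, exec c s (sem c s) t /\ t <= maxcost c.
  by exists (sem c s), t; split=> //; apply: leq_trans cT.
elim: c s lc {cT Qs} => //=; try by [move=> *; eexists; split; [constructor|]].
- move=> c1 IH1 c2 IH2 s /andP[/(IH1 s)[t1 [e1 h1]] /(IH2 (sem c1 s))[t2 [e2 h2]]].
  by exists (t1 + t2); split; [apply: ESeq e1 e2|apply: leq_add].
- move=> b c1 IH1 c2 IH2 s /andP[/(IH1 s)[t1 [e1 h1]] /(IH2 s)[t2 [e2 h2]]].
  case: ifP => bs.
    exists (bcost b + t1).+1; split; first exact: EIfT.
    by rewrite ltnS leq_add2l leq_max h1.
  exists (bcost b + t2).+1; split; first by apply: EIfF => //; rewrite bs.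
  by rewrite ltnS leq_add2l leq_max h2 orbT.
Qed.

(* [I k s] says that [k] operations suffice to finish the loop from [s]. *)
Lemma ok_while b c s T (I : nat -> state R -> Prop) (Q : state R -> Prop) :
  I T s ->
  (forall s' k, agree c s s' -> I k s' ->
     if beval s' b then
       exists2 K, (bcost b + K < k) &
         ok c s' K (fun s'' => I (k - (bcost b + K).+1) s'')
     else (bcost b < k) /\ Q s') ->
  ok (While b c) s T Q.
Proof.
move=> I0 step; suff: forall k s', agree c s s' -> I k s' ->
    exists s'' t, [/\ exec (While b c) s' s'' t, t <= k & Q s''].
  by move=> h; apply: h (agree_refl _ _) I0.
elim/ltn_ind => k IH s' ag Ik; have := step s' k ag Ik.
case: ifP => bs; last first.
  by move=> [kb Qs]; exists s', (bcost b).+1; split=> //; apply: EWhileF; rewrite bs.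
case=> K kK [s1 [t1 [ex1 tK I1]]].
have lt_k : k - (bcost b + K).+1 < k by lia.
have [s2 [t2 [ex2 tk Q2]]] := IH _ lt_k s1 (agree_trans ag (exec_agree ex1)) I1.
exists s2, (bcost b + t1 + t2).+1; split=> //; last by lia.
exact: EWhileT ex1 ex2.
Qed.

(** A round costs the test (4), the loop itself (1), the body (K) and the increment (4). The 6
    stands for the initial assignment (1) and the final failing test (5). *)
Lemma ok_for x e0 y c (I : nat -> state R -> Prop) K s (Q : state R -> Prop)
    (lo := ieval s e0) (N := ivar s y) :
  x != y -> x \notin ivars c -> y \notin ivars c -> lo <= N ->
  I lo (set_ivar s x lo) ->
  (forall k s', lo <= k < N -> agree (For x e0 y c) s s' -> ivar s' x = k ->
     I k s' -> ok c s' K (fun s'' => I k.+1 (set_ivar s'' x k.+1))) ->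
  (forall s', agree (For x e0 y c) s s' -> ivar s' x = N -> I N s' -> Q s') ->
  ok (For x e0 y c) s ((N - lo) * (K + 9) + (icost e0 + 6)) Q.
Proof.
move=> xy xc yc loN I0 step fin.
have agF c' s1 s2 : c' = Seq c (ISet x (IAdd (IVar x) (ICst 1))) ->
    agree c' s1 s2 -> agree (For x e0 y c) s1 s2.
  by move=> ->; apply: agree_sub => // z /= hz; rewrite inE hz orbT.
have ag0 : agree (For x e0 y c) s (set_ivar s x lo).
  by split=> // z; rewrite /= inE negb_or => /andP[/negPf zx _]; rewrite /upd zx.
rewrite (_ : _ + (_ + _) = (icost e0).+1 + ((N - lo) * (K + 9) + 5)); last by lia.
apply: ok_seq; apply: ok_block => //= _.
pose J k s' := exists i, [/\ lo <= i <= N, ivar s' x = i, I i s' &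
                             k = (N - i) * (K + 9) + 5].
apply: (ok_while (I := J)); first by exists lo; rewrite leqnn loN /= /upd eqxx.
move=> s' k ag [i [/andP[loi iN] ix Ii ->]].
have ags : agree (For x e0 y c) s s'.
  by apply: agree_trans ag0 _; apply: agF ag.
have yN : ivar s' y = N.
  have [ag1 _ _ _] := ag; rewrite ag1; first by rewrite /= /upd eq_sym (negPf xy).
  by rewrite /= mem_cat negb_or yc mem_seq1 eq_sym.
rewrite /= ix yN -ltnNge; case: ltnP => [lt_iN|Ni].
  exists (K + 4); first by nia.
  apply: ok_seq; apply: ok_mono (step i s' _ ags ix Ii) (leqnn _) _.
    by rewrite loi.
  move=> s1 [ag1 _ _ _] I1 _; apply: ok_block => //=.
  rewrite ag1 // ix; exists i.+1; rewrite addn1 /= /upd eqxx; split=> //.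
  - by rewrite lt_iN andbT leqW.
  - by nia.
split; first by lia.
have eN : N = i by apply/eqP; rewrite eqn_leq Ni iN.
by apply: fin; rewrite ?ix ?eN.
Qed.

End Logic.

(** * Merge sort *)

Definition slice (a : nat -> nat) (i j : nat) : seq nat :=
  [seq a k | k <- index_iota i j].

Lemma slice_nil a i j : j <= i -> slice a i j = [::].
Proof. by move=> /eqP ji; rewrite /slice /index_iota ji. Qed.

Lemma slice_cons a i j : i < j -> slice a i j = a i :: slice a i.+1 j.
Proof. by move=> ij; rewrite /slice /index_iota subnS -[j - i]prednK ?subn_gt0. Qed.

Lemma slice_cat a i k j : i <= k <= j -> slice a i j = slice a i k ++ slice a k j.
Proof.
move=> /andP[ik kj]; rewrite -map_cat; congr map; rewrite /index_iota.
have -> : j - i = (k - i) + (j - k) by lia.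
by rewrite iotaD subnKC.
Qed.

Lemma slice_rcons a i k : i <= k -> slice a i k.+1 = rcons (slice a i k) (a k).
Proof.
move=> ik; rewrite (@slice_cat a i k) ?ik ?leqnSn // [slice a k _]slice_cons //.
by rewrite (@slice_nil a k.+1) // cats1.
Qed.

Lemma eq_slice a b i j : (forall k, i <= k < j -> a k = b k) -> slice a i j = slice b i j.
Proof. by move=> ab; apply/eq_in_map => k; rewrite mem_index_iota; apply: ab. Qed.

Lemma size_slice a i j : size (slice a i j) = j - i.
Proof. by rewrite size_map size_iota. Qed.

Lemma nth_slice x0 a i j k : k < j - i -> nth x0 (slice a i j) k = a (i + k).
Proof. by move=> kj; rewrite (nth_map 0) ?size_iota // nth_iota. Qed.

Lemma slice_upd a i k v : i <= k -> slice (upd a k v) i k.+1 = rcons (slice a i k) v.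
Proof.
move=> ik; rewrite slice_rcons // /upd eqxx; congr rcons.
by apply: eq_slice => q /andP[_]; case: ltngtP.
Qed.

Lemma upd3_row T (f : nat -> nat -> nat -> T) b r k v : upd3 f b r k v b r = upd (f b r) k v.
Proof. by rewrite /upd3 !eqxx. Qed.

Lemma upd3_other T (f : nat -> nat -> nat -> T) b r k v r' :
  r' != r -> upd3 f b r k v b r' = f b r'.
Proof. by move=> /negPf rr'; rewrite /upd3 eqxx rr'. Qed.

Lemma merges0 (le : rel nat) s : merge le s [::] = s.
Proof. by case: s. Qed.

Section BlockSorted.
Variable le : rel nat.

(* Each of the blocks of length [w] that start at the multiples of [w] is
   sorted, up to position [M]. *)
Definition block_sorted (w : nat) (a : nat -> nat) (M : nat) : Prop :=
  forall i, i.+1 < M -> ~~ (w %| i.+1) -> le (a i) (a i.+1).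

Lemma block_sorted_slice w a M i j : block_sorted w a M -> w %| i -> j <= i + w ->
  j <= M -> sorted le (slice a i j).
Proof.
move=> bs wi jw jM; apply/(sortedP 0) => k; rewrite size_slice => kj.
rewrite !nth_slice ?addnS //; last exact: ltnW.
apply: bs; first by lia.
by rewrite -addnS dvdn_addr // gtnNdvd //; lia.
Qed.

Lemma block_sorted_extend w a L M :
  w %| L -> block_sorted w a L -> sorted le (slice a L M) -> block_sorted w a M.
Proof.
move=> wL bs /(sortedP 0) so i iM wi; case: (ltngtP i.+1 L) => iL.
- exact: bs.
- have := so (i - L); rewrite size_slice !nth_slice; try lia.
  have -> : L + (i - L) = i by lia.
  have -> : L + (i - L).+1 = i.+1 by lia.
  by apply; lia.
- by rewrite iL wL in wi.
Qed.

Lemma eq_block_sorted w a b M : (forall k, k < M -> a k = b k) ->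
  block_sorted w a M -> block_sorted w b M.
Proof. by move=> ab bs i iM wi; rewrite -!ab ?(ltnW iM) //; apply: bs. Qed.

End BlockSorted.

(* Real arrays: 6 = entries of S above the diagonal, 7 = prefix sums, 8 = the
   positions as real numbers, 9 = entries of the projection.  Integer arrays:
   1 = sorting permutations, 2 = vertices of the majorant. *)
Local Notation vN := (IVar 4).
Local Notation vwidth := (IVar 5).
Local Notation vlev := (IVar 6).
Local Notation vlo := (IVar 7).
Local Notation vmid := (IVar 8).
Local Notation vhi := (IVar 9).
Local Notation vpi := (IVar 10).
Local Notation vpj := (IVar 11).
Local Notation vk := (IVar 12).
Local Notation vlev1 := (IAdd vlev (ICst 1)).
Local Notation key e := (RGet 6 e (ICst 0)).
(** With truncated subtraction this is a minimum; it cuts the last blocks off at N. *)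
Local Notation imin e1 e2 := (ISub e1 (ISub e1 e2)).

Definition merge_step : com :=
  If (BAnd (Ilt vpi vmid)
        (BNot (BAnd (Ilt vpj vhi)
                 (BNot (BRle (key (IGet 1 vlev vpj)) (key (IGet 1 vlev vpi)))))))
    (Seq (IPut 1 vlev1 vk (IGet 1 vlev vpi)) (ISet 10 (IAdd vpi (ICst 1))))
    (Seq (IPut 1 vlev1 vk (IGet 1 vlev vpj)) (ISet 11 (IAdd vpj (ICst 1)))).

Definition merge_init : com :=
  Seq (ISet 8 (imin (IAdd vlo vwidth) vN))
  (Seq (ISet 9 (imin (IAdd vmid vwidth) vN))
  (Seq (ISet 10 vlo) (ISet 11 vmid))).

Definition merge_block : com :=
  Seq merge_init (Seq (For 12 vlo 9 merge_step) (ISet 7 vhi)).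

Definition merge_pass : com :=
  Seq (ISet 7 (ICst 0)) (While (Ilt vlo vN) merge_block).

Definition sort_init : com :=
  Seq (For 12 (ICst 0) 4 (IPut 1 (ICst 0) vk vk))
  (Seq (ISet 5 (ICst 1)) (ISet 6 (ICst 0))).

Definition sort_step : com :=
  Seq merge_pass (Seq (ISet 5 (IAdd vwidth vwidth)) (ISet 6 vlev1)).

(* Bottom-up merge sort of the positions 0, ..., N - 1 by decreasing key; the
   result of pass [l] is row [l] of integer array 1. *)
Definition sort_com : com := Seq sort_init (While (Ilt vwidth vN) sort_step).

Section Sort.
Variable R : realType.
Implicit Types s : state R.

Definition ge_key s : rel nat := fun a b => (rarr s 6 b 0 <= rarr s 6 a 0)%R.

Lemma ge_key_total s : total (ge_key s).
Proof. by move=> a b; rewrite /ge_key orbC le_total. Qed.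

Lemma merge_for_ok s (lo := ivar s 7) (mid := ivar s 8) (hi := ivar s 9)
    (lev := ivar s 6) (a := iarr s 1 lev) :
  lo <= mid -> mid <= hi -> ivar s 10 = lo -> ivar s 11 = mid ->
  ok (For 12 vlo 9 merge_step) s ((hi - lo) * (maxcost merge_step + 9) + 7) (fun s' =>
    [/\ slice (iarr s' 1 lev.+1) lo hi = merge (ge_key s) (slice a lo mid) (slice a mid hi),
        forall q, q < lo -> iarr s' 1 lev.+1 q = iarr s 1 lev.+1 q &
        iarr s' 1 lev = a]).
Proof.
move=> lo_mid mid_hi spi spj.
(* The output so far, followed by the merge of what remains of both runs, is the merge of the full
   runs; [k + mid = i + j] counts the elements already moved. *)
pose I k s' := exists i j, [/\ ivar s' 10 = i /\ ivar s' 11 = j,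
  lo <= i <= mid /\ mid <= j <= hi, k + mid = i + j,
  slice (iarr s' 1 lev.+1) lo k ++ merge (ge_key s) (slice a i mid) (slice a j hi)
    = merge (ge_key s) (slice a lo mid) (slice a mid hi) &
  (forall q, q < lo -> iarr s' 1 lev.+1 q = iarr s 1 lev.+1 q) /\ iarr s' 1 lev = a].
apply: (ok_for (I := I)) => //; first exact: leq_trans mid_hi.
- exists lo, mid; rewrite /= /upd /= spi spj leqnn lo_mid leqnn mid_hi addnC.
  by rewrite slice_nil.
- move=> k s' /andP[lok khi] [agi _ _ agr] s'k.
  move=> [i [j [[ei ej] [/andP[li im] /andP[mj jh]] kij eqm [old row]]]].
  have ek : ge_key s = ge_key s'.
    by apply/funext => x; apply/funext => y; rewrite /ge_key agr.
  have Elev : ivar s' 6 = lev by rewrite agi.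
  have Emid : ivar s' 8 = mid by rewrite agi.
  have Ehi : ivar s' 9 = hi by rewrite agi.
  have new v : slice (upd3 (iarr s') 1 lev.+1 k v 1 lev.+1) lo k.+1 =
      rcons (slice (iarr s' 1 lev.+1) lo k) v by rewrite upd3_row slice_upd.
  have kept v : (forall q, q < lo -> upd3 (iarr s') 1 lev.+1 k v 1 lev.+1 q =
      iarr s 1 lev.+1 q) /\ upd3 (iarr s') 1 lev.+1 k v 1 lev = a.
    split; last by rewrite upd3_other // ltn_eqF.
    by move=> q ql; rewrite upd3_row /upd ltn_eqF ?old // (leq_trans ql).
  apply: ok_block => //=; rewrite Elev Emid Ehi ei ej addn1 s'k -!ltnNge row.
  case: ifP => cond.
  + have /andP[lt_im le_ij] := cond.
    exists i.+1, j; rewrite /= /upd /= ej; split=> //; [by lia|by lia|by lia|].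
    rewrite new cat_rcons -eqm [slice a i mid]slice_cons //.
    case: (ltnP j hi) le_ij => jh'; last by rewrite (slice_nil a jh') !merges0.
    by rewrite [slice a j hi]slice_cons //= negbK ek /ge_key => ->.
  + have jh' : j < hi.
      rewrite ltnNge; apply/negP => hj; move: cond.
      have -> : i < mid by move: khi; lia.
      by rewrite [j < hi]ltnNge hj.
    exists i, j.+1; rewrite /= /upd /= addn1 ei; split=> //; [by lia|by lia|].
    rewrite new cat_rcons -eqm [slice a j hi]slice_cons //.
    case: (ltnP i mid) cond => im'; last by rewrite (slice_nil a im').
    rewrite [slice a i mid]slice_cons //= jh' /= negbK ek /ge_key => /negbT/negPf.
    by rewrite /ge_key => ->.
- move=> s' _ _ [i [j [_ [/andP[li im] /andP[mj jh]] kij + [old row]]]].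
  have [-> ->] : i = mid /\ j = hi by move: kij; rewrite -/hi; lia.
  by rewrite !(slice_nil a (leqnn _)) cats0 => eqm.
Qed.

Lemma merge_block_ok s (N := ivar s 4) (w := ivar s 5) (lev := ivar s 6) (L := ivar s 7) :
  L < N -> 0 < w -> w.*2 %| L ->
  block_sorted (ge_key s) w (iarr s 1 lev) N ->
  block_sorted (ge_key s) w.*2 (iarr s 1 lev.+1) L ->
  perm_eq (slice (iarr s 1 lev.+1) 0 L) (slice (iarr s 1 lev) 0 L) ->
  exists hi, [/\ L < hi <= N, hi = L + w.*2 \/ hi = N &
  ok merge_block s ((hi - L) * 60 + 60) (fun s' =>
    [/\ ivar s' 7 = hi, iarr s' 1 lev = iarr s 1 lev,
        block_sorted (ge_key s) w.*2 (iarr s' 1 lev.+1) hi &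
        perm_eq (slice (iarr s' 1 lev.+1) 0 hi) (slice (iarr s 1 lev) 0 hi)])].
Proof.
move=> LN w0 wL bs bs' pe; set a := iarr s 1 lev.
pose mid := L + w - (L + w - N); pose hi := mid + w - (mid + w - N).
have [Lmid midN mid_hi hiN] : [/\ L <= mid, mid <= N, mid <= hi & hi <= N].
  by rewrite /hi /mid; split; lia.
have mid_w : mid <= L + w by rewrite /mid; lia.
have mid_eq : mid < hi -> mid = L + w by rewrite /hi /mid; lia.
exists hi; split; [by rewrite hiN andbT /hi /mid; lia|by rewrite /hi /mid; lia|].
rewrite (_ : _ + 60 = 29 + ((hi - L) * 60 + 31)); last by lia.
apply: ok_seq; apply: ok_block => // [[agi _ agia agra]].
set s1 := sem _ s; have [e7 e8 e9] : [/\ ivar s1 7 = L, ivar s1 8 = mid & ivar s1 9 = hi] by [].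
have e6 : ivar s1 6 = lev by [].
rewrite (_ : _ + 31 = ((hi - L) * 60 + 29) + 2); last by lia.
apply: ok_seq; apply: ok_mono; first by apply: merge_for_ok; rewrite ?e7 ?e8 ?e9.
  by rewrite e7 e9 (_ : maxcost merge_step = 36) //; lia.
move=> s2; rewrite e6 e7 e8 e9 => [[agi2 _ _ _]] [new old row] _.
apply: ok_block => //=; have e29 : ivar s2 9 = hi by rewrite agi2.
have wdL : w %| L by apply: dvdn_trans wL; rewrite -muln2 dvdn_mulr.
have oldL : slice (iarr s2 1 lev.+1) 0 L = slice (iarr s 1 lev.+1) 0 L.
  by apply: eq_slice => q /andP[_ /old].
have so : sorted (ge_key s) (slice (iarr s2 1 lev.+1) L hi).
  rewrite new; apply: merge_sorted; first exact: ge_key_total.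
    by apply: (block_sorted_slice bs).
  case: (ltnP mid hi) => mh; last by rewrite slice_nil.
  apply: (block_sorted_slice bs) => //; last by rewrite /hi; lia.
  by rewrite (mid_eq mh) dvdn_addr.
rewrite /upd /= e29; split=> //.
- apply: (block_sorted_extend wL _ so); apply: eq_block_sorted bs'.
  by move=> q /old ->.
- have Lhi : L <= hi by apply: leq_trans mid_hi.
  rewrite [slice _ 0 hi](@slice_cat _ 0 L) // [slice a 0 hi](@slice_cat a 0 L) //.
  rewrite oldL new perm_cat // perm_merge -slice_cat ?perm_refl // Lmid.
  exact: mid_hi.
Qed.

Lemma merge_pass_ok s (N := ivar s 4) (w := ivar s 5) (lev := ivar s 6) :
  0 < w -> block_sorted (ge_key s) w (iarr s 1 lev) N ->
  ok merge_pass s (N * 125 + 7) (fun s' =>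
    block_sorted (ge_key s) w.*2 (iarr s' 1 lev.+1) N /\
    perm_eq (slice (iarr s' 1 lev.+1) 0 N) (slice (iarr s 1 lev) 0 N)).
Proof.
move=> w0 bs; rewrite (_ : _ + 7 = 2 + (N * 125 + 5)); last by lia.
apply: ok_seq; apply: ok_block => // _; set s1 := sem _ s.
(* A block costs at most 60 per element plus 60, and the loop adds 5. As blocks are nonempty, 125
   per element suffice. *)
pose I k s' := exists L, [/\ ivar s' 7 = L /\ L <= N, w.*2 %| L \/ L = N,
  iarr s' 1 lev = iarr s 1 lev /\ (N - L) * 125 + 5 <= k,
  block_sorted (ge_key s) w.*2 (iarr s' 1 lev.+1) L &
  perm_eq (slice (iarr s' 1 lev.+1) 0 L) (slice (iarr s 1 lev) 0 L)].
apply: (ok_while (I := I)); first by exists 0; rewrite subn0; split=> //; left.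
move=> s' k [agi _ _ agr] [L [[eL LN] dL [row tk] bs' pe]].
have ek : ge_key s' = ge_key s.
  by apply/funext => x; apply/funext => y; rewrite /ge_key agr.
have [e4 e5 e6] : [/\ ivar s' 4 = N, ivar s' 5 = w & ivar s' 6 = lev] by rewrite !agi.
rewrite /= e4 eL -ltnNge; case: ltnP => [lt_LN|NL]; last first.
  have eN : L = N by apply/eqP; rewrite eqn_leq LN NL.
  by split; [lia|move: bs' pe; rewrite eN].
have {}dL : w.*2 %| L by case: dL => // eN; rewrite eN ltnn in lt_LN.
have := @merge_block_ok s'; cbv zeta; rewrite ek e4 e5 e6 eL row.
case/(_ lt_LN w0 dL bs bs' pe) => hi [/andP[Lhi hiN] hiE okb].
exists ((hi - L) * 60 + 60); first by lia.
apply: ok_mono okb (leqnn _) _ => s2 _ [e7 row2 bs2 pe2].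
exists hi; split=> //; last by split=> //; lia.
by case: hiE => ->; [left; rewrite dvdn_addr|right].
Qed.

Lemma sort_com_ok s (N := ivar s 4) :
  ok sort_com s (N * 13 + up_log 2 N * (N * 125 + 20) + 16) (fun s' =>
    let a := iarr s' 1 (ivar s' 6) in
    perm_eq (slice a 0 N) (iota 0 N) /\
    forall i, i.+1 < N -> ge_key s (a i) (a i.+1)).
Proof.
set U := up_log 2 N.
rewrite (_ : _ + 16 = (N * 13 + 7 + 4) + (U * (N * 125 + 20) + 5)); last by lia.
apply: ok_seq; apply: ok_seq.
pose J k s' := forall q, q < k -> iarr s' 1 0 q = q.
rewrite (_ : N * 13 = (N - 0) * (4 + 9)); last by rewrite subn0.
apply: (ok_for (I := J)) => //.
  move=> k s' kN _ s'k Jk; apply: ok_block => // q; rewrite ltnS leq_eqVlt.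
  case/orP => [/eqP->|qk]; first by rewrite /= s'k upd3_row /upd eqxx.
  by rewrite /= s'k upd3_row /upd ltn_eqF //; apply: Jk.
move=> s1 _ _ J1 _; apply: ok_block => //.
set s2 := sem _ s1 => -[agi2 _ _ agr2].
have {}J1 q : q < N -> iarr s2 1 0 q = q by exact: J1.
have e4 : ivar s2 4 = N by rewrite agi2.
have ek2 : ge_key s2 = ge_key s.
  by apply/funext => x; apply/funext => y; rewrite /ge_key agr2.
pose I k s' := exists l, [/\ ivar s' 6 = l /\ ivar s' 5 = 2 ^ l, l <= U,
  (U - l) * (N * 125 + 20) + 5 <= k,
  perm_eq (slice (iarr s' 1 l) 0 N) (iota 0 N) &
  block_sorted (ge_key s) (2 ^ l) (iarr s' 1 l) N].
apply: (ok_while (I := I)).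
  exists 0; split=> //; first by rewrite subn0.
    have -> : slice (iarr s2 1 0) 0 N = slice id 0 N.
      by apply: eq_slice => q /andP[_ /J1].
    by rewrite /slice map_id /index_iota subn0.
  by move=> i _; rewrite expn0 dvd1n.
move=> s' k [agi _ _ agr] [l [[e6 e5] lU tk pe bs]].
have ek : ge_key s' = ge_key s.
  by rewrite -ek2; apply/funext => x; apply/funext => y; rewrite /ge_key agr.
have {}e4 : ivar s' 4 = N by rewrite agi.
rewrite /= e4 e5 -ltnNge; case: ltnP => [lN|Nl]; last first.
  split; first by lia.
  (* The width has reached N, so no block boundary falls strictly inside and block-sorted means
     sorted. *)
  rewrite e6; split=> // i iN; apply: bs => //.
  by rewrite gtnNdvd // (leq_trans iN).
have lt_lU : l < U.
  rewrite ltn_neqAle lU andbT; apply/eqP => elU.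
  by move: lN; rewrite elU ltnNge up_logP.
exists (N * 125 + 7 + 8); first by nia.
apply: ok_seq; have := @merge_pass_ok s'; cbv zeta; rewrite ek e4 e5 e6.
case/(_ _ bs); first by rewrite expn_gt0.
move=> s3 [t3 [ex3 t3le [bs3 pe3]]]; exists s3, t3; split=> // -[agi3 _ _ _].
apply: ok_block => //; exists l.+1.
rewrite /= /upd /= !agi3 // e5 e6 addn1 addnn -mul2n -expnS; split=> //.
- by nia.
- by apply: perm_trans pe3 pe.
- by rewrite expnS mul2n.
Qed.

End Sort.

(** * Computing the majorant *)

Local Notation vb := (IVar 13).
Local Notation xsum e := (RGet 7 e (ICst 0)).
Local Notation rpos e := (RGet 8 e (ICst 0)).
Local Notation vertex e := (IGet 2 e (ICst 0)).
Local Notation sorted_key := (key (IGet 1 vlev vk)).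
Local Notation vk1 := (IAdd vk (ICst 1)).
Local Notation rslope e1 e2 :=
  (RDiv (RSub (xsum e2) (xsum e1)) (RSub (rpos e2) (rpos e1))).

(** Real variable 4 runs through the values of [extreme]: it starts at lambda (N - 1), with N read
    from real variable 3, and drops by 2 lambda per step. *)
Definition prefix_init : com :=
  Seq (RPut 7 (ICst 0) (ICst 0) (RCst 0))
  (Seq (RPut 8 (ICst 0) (ICst 0) (RCst 0))
       (RSet 4 (RMul (RVar 1) (RSub (RVar 3) (RCst 1))))).

Definition prefix_step : com :=
  Seq (RPut 7 vk1 (ICst 0) (RAdd (xsum vk) (RSub sorted_key (RVar 4))))
  (Seq (RPut 8 vk1 (ICst 0) (RAdd (rpos vk) (RCst 1)))
       (RSet 4 (RSub (RVar 4) (RAdd (RVar 1) (RVar 1))))).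

Definition prefix_com : com := Seq prefix_init (For 12 (ICst 0) 4 prefix_step).

Definition hull_step : com :=
  If (BAnd (Ilt (ICst 0) vb)
        (BRle (rslope (vertex (ISub vb (ICst 1))) (vertex vb))
              (rslope (vertex vb) vk1)))
    (ISet 13 (ISub vb (ICst 1)))
    (Seq (ISet 13 (IAdd vb (ICst 1)))
    (Seq (IPut 2 vb (ICst 0) vk1) (ISet 12 vk1))).

(* Column 0 of integer array 2 is the stack of the vertices of the least concave
   majorant of the prefix sums read so far. *)
Definition hull_com : com :=
  Seq (Seq (ISet 12 (ICst 0)) (Seq (ISet 13 (ICst 0)) (IPut 2 (ICst 0) (ICst 0) (ICst 0))))
    (While (Ilt vk vN) hull_step).

Definition out_step : com :=
  Seq (If (BIle (vertex (IAdd (IVar 3) (ICst 1))) vk)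
         (ISet 3 (IAdd (IVar 3) (ICst 1))) Skip)
      (RPut 9 (IGet 1 vlev vk) (ICst 0)
         (RSub sorted_key (rslope (vertex (IVar 3)) (vertex (IAdd (IVar 3) (ICst 1)))))).

Definition out_com : com := Seq (ISet 3 (ICst 0)) (For 12 (ICst 0) 4 out_step).

Section HullMoves.
Variables (R : realType) (X : nat -> R).

Lemma hull_pop st b k : hull X st b.+1 k -> hull X st b (st b).
Proof.
move=> [st0 _ stS sl ch]; split=> // j jb.
- by apply: stS; apply: ltnW.
- by apply: sl; apply: ltnW.
- by apply: ch; apply: ltnW.
Qed.

Lemma hull_push st b k k' : hull X st b k -> k < k' ->
  (0 < b -> (slope X k k' < slope X (st b.-1) k)%R) -> chord_above X k k' ->
  hull X (upd st b.+1 k') b.+1 k'.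
Proof.
move=> [st0 stb stS sl ch] kk' slk chk.
have old j : j <= b -> upd st b.+1 k' j = st j.
  by move=> jb; rewrite /upd ltn_eqF // ltnS.
have new : upd st b.+1 k' b.+1 = k' by rewrite /upd eqxx.
split=> //.
- move=> j; rewrite ltnS leq_eqVlt => /orP[/eqP->|jb]; first by rewrite new old // stb.
  by rewrite !old ?(ltnW jb) //; apply: stS.
- move=> j; rewrite ltnS leq_eqVlt => /orP[/eqP ejb|jb].
    rewrite ejb new !old ?stb -?ejb //; rewrite -ejb in slk.
    by have := slk isT; rewrite /= -stb -ejb.
  by rewrite !old ?(ltnW jb) //; [apply: sl|apply: ltnW; apply: ltnW].
- move=> j; rewrite ltnS leq_eqVlt => /orP[/eqP->|jb]; first by rewrite new old // stb.
  by rewrite !old ?(ltnW jb) //; apply: ch.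
Qed.

End HullMoves.

Section Fit.
Variable R : realType.
Implicit Types s : state R.

Definition excess s (i : nat) : R :=
  (rarr s 6 (iarr s 1 (ivar s 6) i) 0 - extreme (rvar s 1) (ivar s 4) i)%R.

Lemma prefix_com_ok s (N := ivar s 4) (x := excess s) :
  rvar s 3 = N%:R%R ->
  ok prefix_com s (N * 41 + 22) (fun s' =>
    forall k, k <= N -> rarr s' 7 k 0 = psum x k /\ rarr s' 8 k 0 = k%:R%R).
Proof.
move=> rN; rewrite (_ : _ + 22 = 15 + ((N - 0) * (32 + 9) + 7)); last by lia.
apply: ok_seq; apply: ok_block => // _; set s1 := sem _ s.
pose I k s' := rvar s' 4 = extreme (rvar s 1) N k /\
  forall q, q <= k -> rarr s' 7 q 0 = psum x q /\ rarr s' 8 q 0 = q%:R%R.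
apply: (ok_for (I := I)) => //.
- split; first by rewrite /= /upd /= rN /extreme subr0.
  by move=> q; rewrite leqn0 => /eqP->; rewrite /= /upd3 /= /psum big_ord0.
- move=> k s' kN [agi agrv aga agra] s'k [I4 Iq]; apply: ok_block => //.
  have [I7 I8] := Iq k (leqnn k).
  split; first by rewrite /= /upd /= I4 (agrv 1) // /extreme -addnn -addnn !natrD -!natr1; ring.
  move=> q; rewrite leq_eqVlt => /orP[/eqP->|qk].
    rewrite /= /upd3 /upd /= s'k addn1 !eqxx /= I7 I8 psumS I4 (agi 6) // aga // (agra 6) //.
    by rewrite natr1.
  by rewrite /= /upd3 /upd /= s'k addn1 (ltn_eqF qk) /=; apply: Iq.
- by move=> s' _ _ [].
Qed.

Lemma hull_com_ok s (N := ivar s 4) (X : nat -> R) :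
  (forall k, k <= N -> rarr s 7 k 0 = X k /\ rarr s 8 k 0 = k%:R%R) ->
  ok hull_com s (N * 160 + 20) (fun s' =>
    exists b, hull X (fun j => iarr s' 2 j 0) b N).
Proof.
move=> Xs; rewrite (_ : _ + 20 = 8 + (N * 160 + 12)); last by lia.
apply: ok_seq; apply: ok_block => // _; set s1 := sem _ s.
pose st s' j := iarr s' 2 j 0.
(* The top vertex may lie before k after some pops, but its chord to [k.+1] stays above X. The time
   bound is a potential, 160 per unread position and 80 per vertex above the bottom: a pop releases
   80, and so does a push, which moves k and b together. *)
pose I t s' := exists k b, [/\ ivar s' 12 = k /\ ivar s' 13 = b,
  hull X (st s') b (st s' b), st s' b <= k /\ (k = N -> st s' b = k),
  chord_above X (st s' b) k.+1 & k <= N /\ (N - k) * 160 + b * 80 + 12 <= t].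
apply: (ok_while (I := I)).
  exists 0, 0; split=> //; last by rewrite subn0 addn0.
  exact: chord_above_succ.
move=> s' t [agi _ _ agra] [k [b [[ek eb] hu [stk stN] ch [kN tk]]]].
have e4 : ivar s' 4 = N by rewrite agi.
have X7 i : i <= N -> rarr s' 7 i 0 = X i by move=> /Xs[<- _]; rewrite agra.
have X8 i : i <= N -> rarr s' 8 i 0 = i%:R%R by move=> /Xs[_ <-]; rewrite agra.
rewrite /= e4 ek -ltnNge; case: ltnP => [lt_kN|Nk]; last first.
  have ekN : k = N by apply/eqP; rewrite eqn_leq kN Nk.
  by split; [lia|exists b; move: hu; rewrite stN ekN].
exists 71; first by lia.
apply: ok_block => //=.
have stN' : st s' b <= N by lia.
have s12 i j : i <= N -> j <= N -> slope X i j =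
    ((rarr s' 7 j 0 - rarr s' 7 i 0) / (rarr s' 8 j 0 - rarr s' 8 i 0))%R.
  by move=> iN jN; rewrite !X7 // !X8.
rewrite /upd /= ek eb !addn1 -ltnNge -/(st s' _) -/(st s' _) -(s12 _ k.+1) //.
case: ifP => [/andP[b0]|/negbT cond].
  have [_ _ /(_ b.-1) stS _ /(_ b.-1) chb] := hu.
  rewrite subn1 prednK // in stS chb *.
  have {}stS : st s' b.-1 < st s' b by apply: stS.
  have {}chb : chord_above X (st s' b.-1) (st s' b) by apply: chb.
  rewrite -s12 //; last by lia.
  move=> sl; exists k, b.-1; rewrite (_ : st (set_ivar _ _ _) = st s') //.
  have hu' : hull X (st s') b.-1 (st s' b.-1).
    by apply: (@hull_pop _ _ _ _ (st s' b)); rewrite prednK.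
  split=> //; [by lia| |by split=> //; nia].
  by apply: chord_above_merge sl chb ch; rewrite stS ltnS.
exists k.+1, b.+1.
have -> : st (set_ivar (set_iarr (set_ivar s' 13 b.+1) 2 b.+1 0 k.+1) 12 k.+1) =
    upd (st s') b.+1 k.+1.
  by apply/funext => j; rewrite /st /= /upd3 /upd /= andbT.
rewrite /upd eqxx -/(upd (st s') b.+1 k.+1); split=> //.
- apply: (hull_push hu _ _ ch) => // b0.
  move: cond; rewrite b0 /= subn1 -s12 ?ltNge //.
  have [_ _ /(_ b.-1) stS _ _] := hu; rewrite prednK // in stS.
  by have := stS (leqnn _); lia.
- exact: chord_above_succ.
- by lia.
Qed.

Lemma out_com_ok s (N := ivar s 4) (a := iarr s 1 (ivar s 6)) (X : nat -> R) b
    (st := fun j => iarr s 2 j 0) :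
  (forall k, k <= N -> rarr s 7 k 0 = X k /\ rarr s 8 k 0 = k%:R%R) ->
  hull X st b N -> perm_eq (slice a 0 N) (iota 0 N) ->
  ok out_com s (N * 70 + 20) (fun s' => forall k, k < N ->
    exists j, [/\ j < b, st j <= k < st j.+1 &
      rarr s' 9 (a k) 0 = (rarr s 6 (a k) 0 - slope X (st j) (st j.+1))%R]).
Proof.
move=> Xs [st0 stb stS _ _] pe.
have a_inj i j : i < N -> j < N -> a i = a j -> i = j.
  move=> iN jN eij; apply/eqP.
  rewrite -(@nth_uniq _ 0 (slice a 0 N)) ?size_slice ?subn0 //.
    by rewrite !nth_slice ?subn0 // !add0n eij.
  by rewrite (perm_uniq pe) iota_uniq.
rewrite (_ : _ + 20 = 2 + ((N - 0) * (60 + 9) + 7) + (N + 11)); last by lia.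
(* Before a step, k may be the right end of segment j. Vertices strictly increase, so advancing by
   at most one segment is enough. For N = 0 there is no segment, hence the guard. *)
pose I k s' := exists j, [/\ ivar s' 3 = j,
  0 < N -> j < b /\ st j <= k <= st j.+1 &
  forall q, q < k -> exists j, [/\ j < b, st j <= q < st j.+1 &
      rarr s' 9 (a q) 0 = (rarr s 6 (a q) 0 - slope X (st j) (st j.+1))%R]].
apply: (@ok_mono _ _ _ (2 + ((N - 0) * (60 + 9) + 7))); [|exact: leq_addr|by move=> ? _; apply].
apply: ok_seq; apply: ok_block => // _; set s1 := sem _ s.
apply: (ok_for (I := I)) => //.
- exists 0; split=> // N0; have b0 : 0 < b.
    by rewrite lt0n; apply/eqP => b0; move: N0; rewrite -stb b0 st0.
  by rewrite st0 leq0n b0.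
- move=> k s' /= kN [agi _ agia agra] s'k [j [ej jb Iq]].
  have {jb}[jb /andP[sjk ksj]] := jb (leq_ltn_trans (leq0n _) kN).
  have st_le i : i <= b -> st i <= N.
    move=> ib; rewrite -stb; have [d] := ubnP (b - i).
    elim: d i ib => // d IH i ib; rewrite ltnS => bd.
    move: ib; rewrite leq_eqVlt => /orP[/eqP->//|ib].
    apply: leq_trans (ltnW (stS i ib)) (IH _ ib _); lia.
  have [j' [jb' sk ej']] : exists j', [/\ j' < b, st j' <= k < st j'.+1 &
      ivar (sem (If (BIle (vertex (IAdd (IVar 3) (ICst 1))) vk)
         (ISet 3 (IAdd (IVar 3) (ICst 1))) Skip) s') 3 = j'].
    rewrite /= ej addn1 s'k agia // -/(st _).
    case: (leqP (st j.+1) k) => sk; last by exists j; rewrite sjk sk ej.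
    exists j.+1; rewrite /= /upd /= sk /=.
    have jb' : j.+1 < b.
      by rewrite ltn_neqAle jb andbT; apply/eqP => e; move: sk; rewrite e stb leqNgt kN.
    by split=> //; apply: leq_ltn_trans ksj (stS _ jb').
  apply: ok_block => //; rewrite [sem _ _]/=.
  set s2 := (if _ then _ else _).
  have e3 : ivar s2 3 = j' by [].
  have [e12 e6 ea er0] : [/\ ivar s2 12 = k, ivar s2 6 = ivar s 6,
      iarr s2 = iarr s' & rarr s2 = rarr s'].
    by rewrite /s2; case: ifP => _; split=> //; apply: (agi 6).
  have er i : i != 9 -> rarr s2 i = rarr s i by move=> i9; rewrite er0; apply: agra; rewrite /= inE.
  have {}ea i : iarr s2 i = iarr s i by rewrite ea agia.
  have [sj sj1] : st j' <= N /\ st j'.+1 <= N by split; apply: st_le => //; apply: ltnW.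
  exists j'; split=> [|_|q].
  + by rewrite /= /upd /= e3.
  + by split=> //; case/andP: sk => s1k s2k; rewrite leqW.
  + rewrite ltnS leq_eqVlt => /orP[/eqP->|qk].
      exists j'; split=> //.
      rewrite /= /upd3 /= e12 e6 e3 !ea -/a eqxx /= !er // addn1 -/(st _) -/(st _).
      have [-> ->] := Xs _ sj; have [-> ->] := Xs _ sj1.
      by [].
    have [i [ib si eq9]] := Iq q qk; exists i; split=> //; rewrite -eq9.
    rewrite /= /upd3 /= e12 e6 !ea -/a; case: eqP => [|_] /=; last by rewrite er0.
    by move/(a_inj _ _ (ltn_trans qk kN) kN) => e; rewrite e ltnn in qk.
- by move=> s' _ _ [j [_ _ h]].
Qed.

End Fit.

(** * Reading and writing the matrices *)

Local Notation vi := (IVar 2).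
Local Notation vj := (IVar 3).

Definition copy_com : com :=
  For 2 (ICst 0) 1 (RPut 3 vi (ICst 0) (RGet 0 vi (ICst 0))).

Definition for2 (c : com) : com := For 2 (ICst 0) 0 (For 3 (ICst 0) 0 c).

Definition clip_step : com :=
  Seq (RSet 2 (RGet 1 vi vj))
  (Seq (If (BRle (RVar 2) (RVar 0))
          (If (BRle (RSub (RCst 0) (RVar 0)) (RVar 2)) Skip
              (RSet 2 (RSub (RCst 0) (RVar 0))))
          (RSet 2 (RVar 0)))
       (RPut 4 vi vj (RVar 2))).

Definition flatten_step : com :=
  Seq (RPut 6 (IGet 0 vi vj) (ICst 0) (RGet 2 vi vj))
  (Seq (ISet 4 (IAdd vN (ICst 1))) (RSet 3 (RAdd (RVar 3) (RCst 1)))).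

(* Counts the pairs i < j both as an index and as a real number: the machine has
   no conversion between the two sorts. *)
Definition flatten_com : com :=
  Seq (Seq (ISet 4 (ICst 0)) (RSet 3 (RCst 0)))
    (For 2 (ICst 0) 0 (For 3 (IAdd vi (ICst 1)) 0 flatten_step)).

Definition write_step : com :=
  If (Ilt vi vj) (RPut 5 vi vj (RGet 9 (IGet 0 vi vj) (ICst 0)))
    (If (Ilt vj vi) (RPut 5 vi vj (RGet 9 (IGet 0 vj vi) (ICst 0)))
       (RPut 5 vi vj (RCst 0))).

Section Stages.
Variable R : realType.
Implicit Types s : state R.

Lemma copy_com_ok s (m := ivar s 1) :
  ok copy_com s (m * 15 + 7) (fun s' =>
    forall i, i < m -> rarr s' 3 i 0 = rarr s 0 i 0).
Proof.
rewrite -[m in m * 15]subn0.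
apply: (ok_for (K := 6) (I := fun k s' => forall i, i < k -> rarr s' 3 i 0 = rarr s 0 i 0)) => //.
move=> k s' _ [_ _ _ agr] s'k Ik; apply: ok_block => // i.
rewrite ltnS leq_eqVlt => /orP[/eqP->|ik]; rewrite /= /upd3 /= s'k.
  by rewrite eqxx /= agr.
by rewrite ltn_eqF //=; apply: Ik.
Qed.

Lemma for2_fill c s a (F : nat -> nat -> R) (n := ivar s 0) :
  loopfree c -> 0 \notin ivars c -> 2 \notin ivars c -> 3 \notin ivars c ->
  (forall s' i j, agree (for2 c) s s' -> i < n -> j < n -> ivar s' 2 = i ->
     ivar s' 3 = j -> forall i' j', rarr (sem c s') a i' j' =
       if (i' == i) && (j' == j) then F i j else rarr s' a i' j') ->
  ok (for2 c) s (n * (n * (maxcost c + 9) + 16) + 7) (fun s' =>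
    forall i j, i < n -> j < n -> rarr s' a i j = F i j).
Proof.
move=> lc c0 c2 c3 step.
pose J k s' := forall i j, i < k -> j < n -> rarr s' a i j = F i j.
rewrite (_ : _ + 7 = (n - 0) * (n * (maxcost c + 9) + 7 + 9) + 7); last by lia.
apply: (ok_for (I := J)) => //; first by rewrite /= !(inE, mem_cat) /= orbF.
  by rewrite /= !(inE, mem_cat) /= orbF.
move=> i s1 /= lt_in ag1 ei Ji; have [agi1 _ _ _] := ag1.
have en : ivar s1 0 = n.
  by apply: agi1; rewrite /= !(inE, mem_cat) /= !orbF.
pose J2 k s' := J i s' /\ forall j, j < k -> rarr s' a i j = F i j.
rewrite -{1}en -[ivar s1 0 in X in ok _ _ X]subn0.
apply: (ok_for (I := J2)) => //.
  move=> j s2; rewrite en /= => lt_jn ag2 ej [Ja Jb].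
  have ei2 : ivar s2 2 = i.
    by have [agi2 _ _ _] := ag2; rewrite agi2 // !(inE, mem_cat) /= !orbF.
  have ags : agree (for2 c) s s2.
    apply: agree_trans ag1 _; apply: agree_sub ag2 => z; rewrite /= ?cats0 //.
    by rewrite !(inE, mem_cat) => /orP[|/orP[|]] ->; rewrite ?orbT.
  have st := step s2 i j ags lt_in lt_jn ei2 ej.
  apply: ok_block => //; split=> [i' j' lt_i'i lt_j'n|j' lt_j'j] /=.
    by rewrite st ltn_eqF //= Ja.
  rewrite st eqxx /=; case: eqP => [->//|/eqP ne]; apply: Jb.
  by rewrite ltn_neqAle ne -ltnS.
move=> s2; rewrite en => _ _ [Ja Jb] i' j'; rewrite ltnS leq_eqVlt.
by case/orP => [/eqP->|]; [exact: Jb|exact: Ja].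
Qed.

Lemma clip_com_ok s (n := ivar s 0) :
  ok (for2 clip_step) s (n * (n * 31 + 16) + 7) (fun s' =>
    forall i j, i < n -> j < n -> rarr s' 4 i j = clip (rvar s 0) (rarr s 1 i j)).
Proof.
have := @for2_fill clip_step s 4 (fun i j => clip (rvar s 0) (rarr s 1 i j)).
apply=> // s' i j [_ agr _ aga] _ _ ei ej i' j'.
rewrite /= /upd /= ei ej (agr 0) // (aga 1) // sub0r /clip.
by case: ifP => h1; [case: ifP => h2|]; rewrite /= /upd /upd3 /= ei ej ?(agr 0) ?(aga 1) ?sub0r.
Qed.

Lemma write_com_ok s (n := ivar s 0) :
  ok (for2 write_step) s (n * (n * 27 + 16) + 7) (fun s' =>
    forall i j, i < n -> j < n -> rarr s' 5 i j =
      if i < j then rarr s 9 (iarr s 0 i j) 0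
      else if j < i then rarr s 9 (iarr s 0 j i) 0 else 0%R).
Proof.
have := @for2_fill write_step s 5 (fun i j =>
  if i < j then rarr s 9 (iarr s 0 i j) 0
  else if j < i then rarr s 9 (iarr s 0 j i) 0 else 0%R).
apply=> // s' i j [_ _ agi aga] _ _ ei ej i' j'.
rewrite /= ei ej -!ltnNge.
by case: (ltngtP i j) => h; rewrite /= /upd3 /= ?ei ?ej ?(agi 0) ?(aga 9).
Qed.

Lemma flatten_com_ok s (n := ivar s 0) (K := iarr s 0) :
  (forall i j i' j', i < j < n -> i' < j' < n -> K i j = K i' j' -> i = i' /\ j = j') ->
  ok flatten_com s (n * (n * 25 + 18) + 11) (fun s' =>
    [/\ ivar s' 4 = nbar n, rvar s' 3 = (nbar n)%:R%R &
        forall i j, i < j < n -> rarr s' 6 (K i j) 0 = rarr s 2 i j]).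
Proof.
move=> injK; rewrite (_ : _ + 11 = 4 + ((n - 0) * (n * 25 + 9 + 9) + 7)); last by lia.
apply: ok_seq; apply: ok_block => // _; set s1 := sem _ s.
(* Twice the pairs counted plus twice those with first index at least k; doubling keeps the halving
   of [nbar] out of the loop. *)
pose J k s' := [/\ (ivar s' 4).*2 + (n - k) * (n - k.+1) = n * n.-1,
  rvar s' 3 = (ivar s' 4)%:R%R &
  forall i j, i < k -> i < j < n -> rarr s' 6 (K i j) 0 = rarr s 2 i j].
apply: (ok_for (I := J)) => //; first by split=> //; rewrite /= subn0 subn1.
  move=> i s2 /= lt_in [agi2 _ aga2 agr2] ei [Jn Jr Ja].
  have {}lt_in : i < n by [].
  have en : ivar s2 0 = n by apply: agi2.
  pose J2 k s' := [/\ (ivar s' 4).*2 + (n - i.+1) * (n - i.+2) + (n - k).*2 = n * n.-1,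
    rvar s' 3 = (ivar s' 4)%:R%R,
    forall i' j, i' < i -> i' < j < n -> rarr s' 6 (K i' j) 0 = rarr s 2 i' j &
    forall j, i < j < k -> rarr s' 6 (K i j) 0 = rarr s 2 i j].
  have lo : ieval s2 (IAdd vi (ICst 1)) = i.+1 by rewrite /= ei addn1.
  apply: (@ok_mono _ _ _ ((ivar s2 0 - ieval s2 (IAdd vi (ICst 1))) * (16 + 9) + (3 + 6)));
    [|by rewrite lo en; nia|by move=> ? _; apply].
  apply: (ok_for (I := J2)) => //.
  - by rewrite lo en.
  - split=> //; last first.
      by move=> j; rewrite lo => h; exfalso; lia.
    have -> : ivar (set_ivar s2 3 (ieval s2 (IAdd vi (ICst 1)))) 4 = ivar s2 4 by [].
    rewrite lo -Jn -addnA; congr (_ + _).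
    have [d ->] : exists d, n = i + d.+1 by exists (n - i.+1); lia.
    have -> : i + d.+1 - i.+1 = d by lia.
    have -> : i + d.+1 - i.+2 = d.-1 by lia.
    have -> : i + d.+1 - i = d.+1 by lia.
    by case: d => //= d; rewrite -muln2; nia.
  - move=> j s3; rewrite lo en => /andP[lt_ij lt_jn] [agi3 _ aga3 agr3] ej [Kn Kr Ka Kb].
    have ei3 : ivar s3 2 = i by rewrite agi3.
    have e0 : iarr s3 0 = K by rewrite aga3 // aga2.
    have e2 : rarr s3 2 = rarr s 2 by rewrite agr3 // agr2.
    apply: ok_block => //; split.
    + by rewrite /= /upd /= -Kn; lia.
    + by rewrite /= /upd /= Kr natrD.
    + move=> i' j' lt_i'i lt_j'n; rewrite /= /upd3 /= ei3 ej e0 e2 andbT.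
      case: eqP => [e|_]; last exact: Ka.
      have [e' _] := injK i' j' i j lt_j'n (introT andP (conj lt_ij lt_jn)) e.
      by rewrite e' ltnn in lt_i'i.
    + move=> j' /andP[lt_ij' lt_j'j]; rewrite /= /upd3 /= ei3 ej e0 e2 andbT.
      have lt_j'n : j' < n by apply: leq_trans lt_j'j lt_jn.
      case: eqP => [e|ne].
        have [_ ->//] := injK i j' i j (introT andP (conj lt_ij' lt_j'n))
          (introT andP (conj lt_ij lt_jn)) e.
      apply: Kb; rewrite lt_ij' /= ltn_neqAle -ltnS lt_j'j andbT.
      by apply/eqP => e; apply: ne; rewrite e.
  - move=> s3; rewrite en => _ _ [Kn Kr Ka Kb]; split=> //.
    + by rewrite /= /upd /= -Kn subnn addn0.
    + move=> i' j; rewrite ltnS leq_eqVlt => /orP[/eqP->|]; [exact: Kb|exact: Ka].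
move=> s2 _ _ [Jn Jr Ja].
have eN : ivar s2 4 = nbar n.
  by rewrite /nbar -Jn subnn mul0n addn0 doubleK.
split=> //; first by rewrite Jr eN.
by move=> i j lt_ij; apply: Ja => //; case/andP: lt_ij; apply: ltn_trans.
Qed.

End Stages.

(** * The algorithm *)

Definition project_com : com :=
  Seq copy_com (Seq (for2 clip_step) (Seq flatten_com (Seq sort_com
    (Seq prefix_com (Seq hull_com (Seq out_com (for2 write_step))))))).

Definition project_time (m n : nat) (N := nbar n) : nat :=
  m * 15 + 7 + (n * (n * 31 + 16) + 7 + (n * (n * 25 + 18) + 11 +
  (N * 13 + up_log 2 N * (N * 125 + 20) + 16 + (N * 41 + 22 +
  (N * 160 + 20 + (N * 70 + 20 + (n * (n * 27 + 16) + 7))))))).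

Lemma nbar_le (n : nat) : nbar n <= n * n.
Proof.
rewrite /nbar -divn2; apply: leq_trans (leq_div _ _) _.
by rewrite leq_mul2l leq_pred orbT.
Qed.

(** [m <= n * n] bounds the copy of y, and for [2 <= n] the square is at least 4, which absorbs the
    additive constants. *)
Lemma project_time_le (m n : nat) : 2 <= n -> m <= n * n ->
  project_time m n <= n * n * (600 + 150 * up_log 2 (nbar n)).
Proof.
move=> n2; have := nbar_le n; rewrite /project_time; cbv zeta.
move: (nbar n) (up_log _ _) => N U; set q := n * n => Nq mq.
have q4 : 4 <= q by rewrite /q; nia.
have nq : n <= q by rewrite /q; nia.
have e a b : n * (n * a + b) = q * a + n * b by rewrite /q; nia.
have UN : U * N <= q * U by rewrite mulnC leq_mul2r Nq orbT.
have U4 : 4 * U <= q * U by rewrite leq_mul2r q4 orbT.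
rewrite !e !mulnDr (mulnA U N); lia.
Qed.

(** From 2^(U-1) < N <= n^2 one gets (U-1) ln 2 <= 2 ln n; the third ln n pays for the rounding
    up. *)
Lemma up_log_nbar_le (R : realType) (n : nat) : 2 <= n ->
  ((up_log 2 (nbar n))%:R * ln 2%:R <= 3%:R * ln n%:R :> R)%R.
Proof.
move=> n2; set N := nbar n; set U := up_log 2 N.
have n_gt0 : 0 < n by exact: ltnW.
have n0 : (0 < n%:R :> R)%R by rewrite ltr0n.
have ln2 : (ln 2%:R <= ln n%:R :> R)%R by rewrite ler_ln ?posrE ?ler_nat.
have ln0 : (0 <= ln 2%:R :> R)%R by rewrite ln_ge0 // ler1n.
case: (leqP N 1) => N1.
  have -> : U = 0 by apply/eqP; rewrite up_log_eq0 N1 orbT.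
  by rewrite mul0r mulr_ge0 // (le_trans ln0).
have /andP[lo _] := up_log_bounds (isT : 1 < 2) N1.
have U0 : 0 < U by rewrite up_log_gt0 N1.
have : (ln (2%:R ^+ U.-1) <= ln (n%:R ^+ 2) :> R)%R.
  rewrite ler_ln ?posrE ?exprn_gt0 ?ltr0n // -!natrX ler_nat.
  by apply: leq_trans (ltnW lo) _; rewrite -mulnn nbar_le.
rewrite !lnXn ?ltr0n //.
rewrite -[(ln 2 *+ _)%R]mulr_natl [(ln n%:R *+ 2)%R]mulr2n.
have -> : (U%:R = U.-1%:R + 1 :> R)%R by rewrite natr1 prednK.
by rewrite mulrDl mul1r; lra.
Qed.

Lemma upper_of n i j : i < j < n ->
  exists p : upper n, (val p).1 = i :> nat /\ (val p).2 = j :> nat.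
Proof.
move=> /andP[ij jn].
by exists (exist (fun p : 'I_n * 'I_n => p.1 < p.2)
  (Ordinal (ltn_trans ij jn), Ordinal jn) ij).
Qed.

Section Main.
Variables (R : realType) (m n : nat) (K : enumeration n) (rho lam : R).
Variables (y : 'cV[R]_m) (W S : 'M[R]_n).
Hypotheses (bijK : bijective K) (lam0 : (0 < lam)%R) (symS : Sym S).

Lemma project_com_ok s : holds_input K rho lam (y, W, S) s ->
  ok project_com s (project_time m n) (fun s' => exists PS,
    [/\ Sset K lam PS,
        forall Q, Sset K lam Q -> (0 <= mxdot (S - PS) (PS - Q))%R &
        holds_output (y, map_mx (clip rho) W, PS) s']).
Proof.
move=> [[i0 i1] [r0 r1] aK aY [/= aW aS]].
set N := nbar n.
have injK i j i' j' : i < j < n -> i' < j' < n ->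
    iarr s 0 i j = iarr s 0 i' j' -> i = i' /\ j = j'.
  move=> /upper_of[p [<- <-]] /upper_of[p' [<- <-]].
  by rewrite !aK => /ord_inj /(bij_inj bijK) ->.
have := copy_com_ok s; cbv zeta; rewrite i1 => ok1.
apply: ok_seq; apply: ok_mono ok1 (leqnn _) _ => s1 _ o1 [a1i a1r a1a a1R].
have := clip_com_ok s1; cbv zeta; rewrite a1i // i0 => ok2.
apply: ok_seq; apply: ok_mono ok2 (leqnn _) _ => s2 _ o2 [a2i a2r a2a a2R].
have e20 : iarr s2 0 = iarr s 0 by rewrite a2a // a1a.
have := flatten_com_ok (s := s2); cbv zeta; rewrite e20 a2i // a1i // i0.
move=> /(_ injK) ok3.
apply: ok_seq; apply: ok_mono ok3 (leqnn _) _ => s3 _ [eN rN o3] [a3i a3r a3a a3R].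
have := sort_com_ok s3; cbv zeta; rewrite eN => ok4.
apply: ok_seq; apply: ok_mono ok4 (leqnn _) _ => s4 _ [pe so] [a4i a4r a4a a4R].
have := prefix_com_ok (s := s4); cbv zeta; rewrite a4i // a4r // eN rN => /(_ erefl) ok5.
apply: ok_seq; apply: ok_mono ok5 (leqnn _) _ => s5 _ o5 [a5i a5r a5a a5R].
have := hull_com_ok (s := s5) (X := psum (excess s4)); cbv zeta.
rewrite a5i // a4i // eN => /(_ o5) ok6.
apply: ok_seq; apply: ok_mono ok6 (leqnn _) _ => s6 _ [b hu] [a6i a6r a6a a6R].
have := @out_com_ok _ s6 (psum (excess s4)) b; cbv zeta.
rewrite a6i // a5i // a4i // eN (a6i 6) // (a5i 6) // (a6a 1) // (a5a 1) //.
rewrite (a6R 7) // (a6R 8) // (a6R 6) // (a5R 6) // (a4R 6) // => /(_ o5 hu pe) ok7.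
apply: ok_seq; apply: ok_mono ok7 (leqnn _) _ => s7 _ o7 [a7i a7r a7a a7R].
have := write_com_ok s7; cbv zeta.
rewrite a7i // a6i // a5i // a4i // a3i // a2i // a1i // i0 => ok8.
apply: ok_mono ok8 (leqnn _) _ => s8 [_ _ _ a8R] o8.
have e70 : iarr s7 0 = iarr s 0 by rewrite a7a // a6a // a5a // a4a // a3a.
set a := iarr s4 1 (ivar s4 6) in pe so o7.
pose f id := rarr s3 6 id 0; pose g id := rarr s7 9 id 0.
have fS p : f (K p) = S (val p).1 (val p).2.
  rewrite /f -aK o3 ?ltn_ord ?andbT; last exact: (valP p).
  by rewrite a2R // a1R // aS.
have ex k : excess s4 k = (f (a k) - extreme lam N k)%R.
  by rewrite /excess a4R // a4r // a3r // a2r // a1r // r1 (a4i 4) // eN.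
(* The slopes are read back from the output, which makes [gE] immediate and leaves their majorant
   property to [hull_slopes]. *)
pose v k := (f (a k) - g (a k))%R.
have vP : majorant_slopes N (fun k => (f (a k) - extreme lam N k)%R) v.
  rewrite -(funext ex : excess s4 = _); apply: (hull_slopes hu) => k kN.
  have [j [jb jk e]] := o7 k kN; exists j; split=> //.
  by rewrite /v /g e /f opprB addrC subrK.
have peN : perm_eq [seq a k | k <- iota 0 N] (iota 0 N).
  by move: pe; rewrite /slice /index_iota subn0.
have gE k : k < N -> g (a k) = (f (a k) - v k)%R by rewrite /v opprB addrC subrK.
have [P1 P2] := Sset_proj (ltW lam0) bijK symS fS peN so vP gE.
exists (sym_of K (fun a => g a)); split=> //; split=> [i|i j|i j] /=.
- by rewrite a8R // a7R // a6R // a5R // a4R // a3R // a2R // o1 // aY.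
- rewrite a8R // a7R // a6R // a5R // a4R // a3R // o2 // mxE.
  by rewrite a1R // a1r // r0 aW.
- rewrite o8 // e70 mxE.
  case: insubP => [p ij ep|nij].
    by rewrite (ij : i < j); have := aK p; rewrite ep /= => ->.
  rewrite (negbTE (nij : ~~ (i < j))); case: insubP => [p ji ep|nji].
    by rewrite (ji : j < i); have := aK p; rewrite ep /= => ->.
  by rewrite (negbTE (nji : ~~ (j < i))).
Qed.

Definition entry p q (A : 'M[R]_(p, q)) (i j : nat) : R :=
  if insub i is Some i' then if insub j is Some j' then A i' j' else 0%R else 0%R.

Lemma entryE p q (A : 'M[R]_(p, q)) (i : 'I_p) (j : 'I_q) : entry A i j = A i j.
Proof. by rewrite /entry !valK. Qed.

Definition table (i j : nat) : nat :=
  if (insub i, insub j) is (Some i', Some j') then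
    if (insub (i', j') : option (upper n)) is Some p then K p : nat else 0
  else 0.

Lemma tableE (p : upper n) : table (val p).1 (val p).2 = K p.
Proof. by rewrite /table !valK -surjective_pairing valK. Qed.

(** Gives the program a memory to run on, and thereby the projection onto S, which has to be named
    before any particular memory is considered. *)
Lemma holds_input_exists : exists s : state R, holds_input K rho lam (y, W, S) s.
Proof.
exists (State (fun x => if x == 0 then n else m) (fun x => if x == 0 then rho else lam)
  (fun _ => table)
  (fun a => if a == 0 then entry y else if a == 1 then entry W else entry S)).
split=> //=.
- exact: tableE.
- by move=> i; rewrite -(entryE y i ord0).
- by split=> i j; rewrite entryE.
Qed.

End Main.

Local Open Scope ring_scope.

Theorem theorem4p2 (R : realType) :
  exists (c : com) (C : R),
    forall (m n : nat) (A : 'M[R]_n -> 'cV[R]_m) (K : enumeration n)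
           (rho lam : R) (y : 'cV[R]_m) (W S : 'M[R]_n),
      linear_onto A -> bijective K -> 0 < rho -> 0 < lam ->
      Sym W -> Sym S ->
      exists PW PS : 'M[R]_n,
        [/\ is_projection (@mxdot R n n) (@Wset R n rho) W PW,
            is_projection (@mxdot R n n) (Sset K lam) S PS,
            is_projection (@tripledot R m n) (@Mset R m n K rho lam)
              (y, W, S) (y, PW, PS) &
            forall s : state R, holds_input K rho lam (y, W, S) s ->
              exists (s' : state R) (t : nat),
                [/\ exec c s s' t,
                    holds_output (y, PW, PS) s' &
                    (2 <= n)%N -> t%:R <= C * n%:R ^+ 2 * ln n%:R]].
Proof.
(* For n >= 2, 600 ln 2 <= 600 ln n and 150 U ln 2 <= 450 ln n. *)
exists project_com, ((600 + 450) / ln 2%:R).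
move=> m n A K rho lam y W S linA bijK rho0 lam0 symW symS.
have [PW1 PW2] := clip_proj rho0 symW; set PW := map_mx (clip rho) W in PW1 PW2.
have [s0 hs0] := holds_input_exists K rho lam y W S.
have [_ [_ [_ _ [PS [PS1 PS2 _]]]]] := project_com_ok bijK lam0 symS hs0.
have projS P : Sset K lam P -> (forall Q, Sset K lam Q -> 0 <= mxdot (S - P) (P - Q)) ->
    is_projection (@mxdot R n n) (Sset K lam) S P.
  by apply: projection_variational => *; [exact: mxdot_sqD|exact: mxdot_ge0|exact: mxdot_gt0].
exists PW, PS; split.
- by apply: projection_variational => *; [exact: mxdot_sqD|exact: mxdot_ge0|exact: mxdot_gt0| |exact: PW2].
- exact: projS.
- exact: is_projection_triple.
move=> s hs.
have [s' [t [ex_s le_t [PS' [PS1' PS2' out]]]]] := project_com_ok bijK lam0 symS hs.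
(* PS comes from the run on [s0]; uniqueness makes the run on s produce the same matrix. *)
have ePS : PS' = PS by apply: projection_unique (projS _ PS1' PS2') (projS _ PS1 PS2).
exists s', t; split=> //; first by rewrite -ePS.
move=> n2; have mn := linear_onto_dim linA.
have ln2_gt0 : 0 < ln 2%:R :> R by rewrite ln_gt0 // ltr1n.
have lnn : ln 2%:R <= ln n%:R :> R.
  by rewrite ler_ln ?posrE ?ltr0n ?ler_nat // (ltn_trans _ n2).
have := up_log_nbar_le R n2; set U := up_log 2 (nbar n) => leU.
apply: (@le_trans _ _ ((n * n * (600 + 150 * U))%:R)).
  by rewrite ler_nat (leq_trans le_t) // project_time_le.
rewrite !natrM natrD natrM -!expr2.
rewrite -(ler_pM2r ln2_gt0).
rewrite (_ : _ / ln 2%:R * _ * _ * _ = n%:R ^+ 2 * ((600 + 450) * ln n%:R)); last first.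
  by field; rewrite gt_eqF.
rewrite -mulrA ler_wpM2l ?exprn_ge0 ?ler0n // mulrDl -mulrA; lra.
Qed.
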